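(* Let $\mathbb{K}$ be an algebraically closed field of characteristic $p>0$, let $\mathfrak{l}$ be a semisimple restricted Lie algebra over $\mathbb{K}$ with basis $\{e_i\mid i\in I\}$, and let $\mathfrak{g}=\mathfrak{l}\otimes\mathbb{K}[x]$ (with $\mathbb{I}=\mathbb{N}$) or $\mathfrak{g}=\mathfrak{l}\otimes\mathbb{K}[x,x^{-1}]$ (with $\mathbb{I}=\mathbb{Z}$) be its current algebra or loop algebra. Put $e_{ir}=e_i\otimes x^r$. Then the center $Z(\mathfrak{g})$ of $U(\mathfrak{g})$ is freely generated by $$\{e_{ir}^p-e_{ir}^{[p]}\mid i\in I, r\in\mathbb{I}\}.$$
   Context: The current algebra $\mathfrak{l}\otimes\mathbb{K}[x]$ and the loop algebra $\mathfrak{l}\otimes\mathbb{K}[x,x^{-1}]$ have Lie bracket $[e\otimes x^r,f\otimes x^s]=[e,f]\otimes x^{r+s}$ for $e,f\in\mathfrak{l}$ and $r,s\in\mathbb{N}$ (resp. $r,s\in\mathbb{Z}$), where $\mathbb{N}$ includes $0$. The $p$-th power map of $\mathfrak{l}$ induces a restricted structure on $\mathfrak{g}$ determined by $(e_i\otimes x^r)^{[p]}=e_i^{[p]}\otimes x^{rp}$. $Z(\mathfrak{g})=\{z\in U(\mathfrak{g})\mid zu=uz\ \forall u\in U(\mathfrak{g})\}$; $e_{ir}^p$ denotes the $p$-th power in $U(\mathfrak{g})$. ''Freely generated'' means that the given elements generate the algebra as a commutative $\mathbb{K}$-algebra and are algebraically independent. A Lie algebra is semisimple if it has no nonzero solvable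 ideals. *)

(* Defs.v *)
From HB Require Import structures.
From mathcomp Require Import all_boot all_order all_algebra finmap monalg.
From mathcomp Require Import boolp classical_sets.

Set Implicit Arguments.
Unset Strict Implicit.
Unset Printing Implicit Defensive.

Import GRing.Theory.
Local Open Scope classical_set_scope.
Local Open Scope quotient_scope.
Local Open Scope ring_scope.

HB.mixin Record Lmodule_isLieAlgebra (K : fieldType) L of GRing.Lmodule K L := {
  lie_bracket : L -> L -> L;
  lie_linearl : forall z, linear (lie_bracket^~ z);
  lie_linearr : forall z, linear (lie_bracket z);
  lie_xx : forall x, lie_bracket x x = 0;
  lie_jacobi : forall x y z,
    lie_bracket x (lie_bracket y z) + lie_bracket y (lie_bracket z x)
      + lie_bracket z (lie_bracket x y) = 0
}.

#[short(type="lieAlgType")]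
HB.structure Definition LieAlgebra (K : fieldType) :=
  {L of GRing.Lmodule K L & Lmodule_isLieAlgebra K L}.

Notation "[lie x , y ]" := (lie_bracket x y)
  (at level 0, x, y at level 99, format "[lie  x ,  y ]") : ring_scope.

Section Sets.
Context (K : fieldType).

Definition is_subspace (V : lmodType K) (S : set V) : Prop :=
  S 0 /\ forall (a : K) u v, S u -> S v -> S (a *: u + v).

Definition linear_span (V : lmodType K) (S : set V) : set V := smallest (@is_subspace V) S.

Definition is_subalgebra (A : lalgType K) (S : set A) : Prop :=
  [/\ is_subspace S, S 1 & forall u v, S u -> S v -> S (u * v)].

Definition two_sided_ideal (A : nzRingType) (S : set A) : Prop :=
  [/\ S 0, forall u v, S u -> S v -> S (u - v)
    & forall a u b, S u -> S (a * u * b)].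

Definition ring_center (A : nzRingType) : set A :=
  [set z | forall u, z * u = u * z].

(* Families indexed by an arbitrary, possibly infinite, type: linear
   independence and generation involve finitely many distinct indices. *)
Definition is_basis (V : lmodType K) (I : Type) (e : I -> V) : Prop :=
  (forall (n : nat) (j : 'I_n -> I) (a : 'I_n -> K), injective j ->
     \sum_(k < n) a k *: e (j k) = 0 -> forall k, a k = 0) /\
  linear_span (range e) = setT.

(* The images [v k] are meant to commute with each other. *)
Definition mpoly_eval (A : lalgType K) (n : nat) (v : 'I_n -> A)
    (P : {mpoly K[n]}) : A :=
  mmap (in_alg A) (fun m : 'X_{1..n} => \prod_(k < n) v k ^+ m k) P.

Definition alg_independent (A : lalgType K) (J : Type) (y : J -> A) : Prop :=
  forall (n : nat) (j : 'I_n -> J) (P : {mpoly K[n]}), injective j ->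
    mpoly_eval (y \o j) P = 0 -> P = 0.

(* Being generated by [y] as a commutative algebra: [Z] is commutative and is
   the smallest subalgebra of [A] containing all the [y k]. *)
Definition freely_generated (A : lalgType K) (Z : set A) (J : Type)
    (y : J -> A) : Prop :=
  [/\ forall u v, Z u -> Z v -> u * v = v * u,
      Z = smallest (@is_subalgebra A) (range y)
    & alg_independent y].

End Sets.

Section Semisimple.
Context (K : fieldType) (L : lieAlgType K).

Definition lie_ideal (S : set L) : Prop :=
  is_subspace S /\ forall x u, S u -> S [lie x, u].

Definition lie_derived (S : set L) : set L :=
  linear_span [set w | exists u v, [/\ S u, S v & w = [lie u, v]]].

Definition lie_solvable (S : set L) : Prop :=
  exists n, iter n lie_derived S `<=` [set 0].

Definition lie_semisimple : Prop :=
  forall S : set L, lie_ideal S -> lie_solvable S -> S = [set 0].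

End Semisimple.

(* [lmonoid L M] is L ⊗ K[M], where K[M] is the monoid algebra of the
   commutative monoid M: its elements are the finite sums of x_r ⊗ X^r, and
   are encoded as the finitely supported families (x_r)_(r in M) in L. *)
Definition lmonoid (K : fieldType) (L : lieAlgType K) (M : nmodType) :=
  {malg L[M]}.

HB.instance Definition _ (K : fieldType) (L : lieAlgType K) (M : nmodType) :=
  GRing.Zmodule.on (lmonoid L M).

Definition lmonom (K : fieldType) (L : lieAlgType K) (M : nmodType)
  (x : L) (r : M) : lmonoid L M := << x *g r >>.

Notation "x ⊗X^ r" := (lmonom x r) (at level 30, r at level 8,
  format "x  ⊗X^ r") : ring_scope.

(* L ⊗ K[x] and L ⊗ K[x, x^-1] *)
Notation current L := (lmonoid L nat).
Notation loop L := (lmonoid L int).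

Section LieBracketTheory.
Context (K : fieldType) (L : lieAlgType K).
Implicit Types (a : K) (x y z : L).

Lemma lie_xD x y z : [lie x, y + z] = [lie x, y] + [lie x, z].
Proof. by have := lie_linearr x 1 y z; rewrite !scale1r. Qed.
Lemma lie_Dx x y z : [lie y + z, x] = [lie y, x] + [lie z, x].
Proof. by have := lie_linearl x 1 y z; rewrite !scale1r. Qed.
Lemma lie_x0 x : [lie x, 0] = 0.
Proof. by apply: (addIr [lie x, 0]); rewrite -lie_xD !add0r. Qed.
Lemma lie_0x x : [lie 0, x] = 0.
Proof. by apply: (addIr [lie 0, x]); rewrite -lie_Dx !add0r. Qed.
Lemma lie_Zx a x y : [lie a *: x, y] = a *: [lie x, y].
Proof. by have := lie_linearl y a x 0; rewrite lie_0x !addr0. Qed.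

Lemma lie_anti x y : [lie x, y] + [lie y, x] = 0.
Proof.
by have := lie_xx (x + y); rewrite lie_Dx !lie_xD !lie_xx add0r addr0.
Qed.

End LieBracketTheory.

HB.lock Definition lmscale (K : fieldType) (L : lieAlgType K) (M : nmodType)
    (a : K) (u : lmonoid L M) : lmonoid L M :=
  \sum_(r <- msupp u) (a *: u@_r) ⊗X^ r.
Arguments lmscale {K L M} a u.

HB.lock Definition lmbracket (K : fieldType) (L : lieAlgType K) (M : nmodType)
    (u v : lmonoid L M) : lmonoid L M :=
  \sum_(r <- msupp u) \sum_(s <- msupp v) [lie u@_r, v@_s] ⊗X^ (r + s).
Arguments lmbracket {K L M} u v.

Section LmonoidLie.
Context (K : fieldType) (L : lieAlgType K) (M : nmodType).
Implicit Types (x y : L) (r s : M) (u v w : lmonoid L M) (a : K).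
Local Notation lmscale := (@lmscale K L M).
Local Notation lmbracket := (@lmbracket K L M).

Lemma lmscaleE a u r : (lmscale a u)@_r = a *: u@_r.
Proof.
rewrite lmscale.unlock raddf_sum /=; have [ru|ru] := boolP (r \in msupp u).
  rewrite (big_fsetD1 r) //= mcoeffUU big1_fset ?addr0 // => s.
  by rewrite in_fsetD1 mcoeffU; case: eqP.
rewrite (mcoeff_outdom ru) scaler0 big1_fset // => s su _.
by rewrite mcoeffU; case: eqP ru => // <-; rewrite su.
Qed.

Lemma lmscaleA a b u : lmscale a (lmscale b u) = lmscale (a * b) u.
Proof. by apply/malgP => r; rewrite !lmscaleE scalerA. Qed.
Lemma lmscale1 : left_id 1 lmscale.
Proof. by move=> u; apply/malgP => r; rewrite lmscaleE scale1r. Qed.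
Lemma lmscaleDr : right_distributive lmscale +%R.
Proof.
by move=> a u v; apply/malgP => r; rewrite mcoeffD !lmscaleE mcoeffD scalerDr.
Qed.
Lemma lmscaleDl u : {morph lmscale^~ u : a b / a + b}.
Proof.
by move=> a b; apply/malgP => r; rewrite mcoeffD !lmscaleE scalerDl.
Qed.

HB.instance Definition _ := GRing.Zmodule_isLmodule.Build K (lmonoid L M)
  lmscaleA lmscale1 lmscaleDr lmscaleDl.

Lemma scale_lmonom a x r : a *: (x ⊗X^ r) = (a *: x) ⊗X^ r.
Proof.
by apply/malgP => s; rewrite lmscaleE !mcoeffU scalerMnr.
Qed.

Lemma lmonomD r : {morph (fun x => x ⊗X^ r) : x y / x + y}.
Proof. exact: monalgUD. Qed.

Lemma lmonom0 r : (0 : L) ⊗X^ r = 0.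
Proof. exact: monalgU0. Qed.

Lemma lmonoid_ind (P : lmonoid L M -> Prop) :
  P 0 -> (forall x r u, P u -> P (x ⊗X^ r + u)) -> forall u, P u.
Proof.
move=> P0 PD u; rewrite [u]monalgE.
elim: (enum_fset _) => [|r s IH]; first by rewrite big_nil.
by rewrite big_cons; apply: PD.
Qed.

Lemma lmbracketw (d1 d2 : {fset M}) u v :
    (msupp u `<=` d1)%fset -> (msupp v `<=` d2)%fset ->
  lmbracket u v = \sum_(r <- d1) \sum_(s <- d2) [lie u@_r, v@_s] ⊗X^ (r + s).
Proof.
move=> le1 le2; rewrite lmbracket.unlock (big_fset_incl _ le1) /=.
  apply: eq_bigr => r _; apply: big_fset_incl => // s _ /mcoeff_outdom ->.
  by rewrite lie_x0 lmonom0.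
move=> r _ /mcoeff_outdom ur; rewrite big1 // => s _.
by rewrite ur lie_0x lmonom0.
Qed.

Lemma lmbracketDl u v w : lmbracket (u + v) w = lmbracket u w + lmbracket v w.
Proof.
have Sw := fsubset_refl (msupp w).
rewrite (lmbracketw (msuppD_le u v) Sw).
rewrite (lmbracketw (fsubsetUl _ (msupp v)) Sw).
rewrite (lmbracketw (fsubsetUr (msupp u) _) Sw) -big_split /=.
apply: eq_bigr => r _; rewrite -big_split /=; apply: eq_bigr => s _.
by rewrite mcoeffD lie_Dx lmonomD.
Qed.

Lemma lmbracketDr u v w : lmbracket w (u + v) = lmbracket w u + lmbracket w v.
Proof.
have Sw := fsubset_refl (msupp w).
rewrite (lmbracketw Sw (msuppD_le u v)).
rewrite (lmbracketw Sw (fsubsetUl _ (msupp v))).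
rewrite (lmbracketw Sw (fsubsetUr (msupp u) _)) -big_split /=.
apply: eq_bigr => r _; rewrite -big_split /=; apply: eq_bigr => s _.
by rewrite mcoeffD lie_xD lmonomD.
Qed.

Lemma lmbracket0l u : lmbracket 0 u = 0.
Proof. by rewrite lmbracket.unlock msupp0 big_seq_fset0. Qed.

Lemma lmbracket0r u : lmbracket u 0 = 0.
Proof.
by rewrite lmbracket.unlock big1 // => r _; rewrite msupp0 big_seq_fset0.
Qed.

Lemma lmbracketE x y r s :
  lmbracket (x ⊗X^ r) (y ⊗X^ s) = [lie x, y] ⊗X^ (r + s).
Proof. by rewrite (lmbracketw msuppU_le msuppU_le) !big_seq_fset1 !mcoeffUU. Qed.

Lemma lmbracket_linearl w : linear (lmbracket^~ w).
Proof.
move=> a u v; rewrite lmbracketDl; congr (_ + _).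
elim/lmonoid_ind: u => [|x r u IH]; first by rewrite scaler0 lmbracket0l scaler0.
rewrite scalerDr !lmbracketDl scalerDr IH; congr (_ + _).
elim/lmonoid_ind: w {IH} => [|y s w IH]; first by rewrite !lmbracket0r scaler0.
rewrite !lmbracketDr scalerDr IH; congr (_ + _).
by rewrite scale_lmonom !lmbracketE scale_lmonom lie_Zx.
Qed.

Lemma lmbracket_anti u v : lmbracket u v + lmbracket v u = 0.
Proof.
elim/lmonoid_ind: u => [|x r u IH]; first by rewrite lmbracket0l lmbracket0r addr0.
rewrite lmbracketDl lmbracketDr addrACA IH addr0.
elim/lmonoid_ind: v {IH} => [|y s v IH]; first by rewrite lmbracket0l lmbracket0r addr0.
rewrite lmbracketDl lmbracketDr addrACA IH addr0.
by rewrite !lmbracketE [s + r]addrC -lmonomD lie_anti lmonom0.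
Qed.

Lemma lmbracket_linearr w : linear (lmbracket w).
Proof.
move=> a u v.
have antiE t : lmbracket w t = - lmbracket t w.
  by apply/eqP; rewrite -subr_eq0 opprK lmbracket_anti.
by rewrite !antiE lmbracket_linearl opprD scalerN.
Qed.

Lemma lmbracketxx u : lmbracket u u = 0.
Proof.
elim/lmonoid_ind: u => [|x r u IH]; first exact: lmbracket0l.
rewrite lmbracketDl !lmbracketDr IH addr0 lmbracketE lie_xx lmonom0 add0r.
exact: lmbracket_anti.
Qed.

Lemma lmbracket_jacobi u v w :
  lmbracket u (lmbracket v w) + lmbracket v (lmbracket w u)
    + lmbracket w (lmbracket u v) = 0.
Proof.
have D3 (a b c d e f : lmonoid L M) :
  a + b + c = 0 -> d + e + f = 0 -> (a + d) + (b + e) + (c + f) = 0.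
  by move=> h1 h2; rewrite (addrACA a) (addrACA (a + b)) h1 h2 addr0.
elim/lmonoid_ind: u => [|x r u IH].
  by rewrite !(lmbracket0l, lmbracket0r) !addr0.
rewrite !(lmbracketDl, lmbracketDr); apply: (D3) => //.
elim/lmonoid_ind: v {IH} => [|y s v IH].
  by rewrite !(lmbracket0l, lmbracket0r) !addr0.
rewrite !(lmbracketDl, lmbracketDr); apply: (D3) => //.
elim/lmonoid_ind: w {IH} => [|z t w IH].
  by rewrite !(lmbracket0l, lmbracket0r) !addr0.
rewrite !(lmbracketDl, lmbracketDr); apply: (D3) => //.
rewrite !lmbracketE [s + (t + r)]addrA [s + t + r]addrC [t + (r + s)]addrC.
by rewrite -[r + s + t]addrA -!lmonomD lie_jacobi lmonom0.
Qed.

HB.instance Definition _ := Lmodule_isLieAlgebra.Build K (lmonoid L M)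
  lmbracket_linearl lmbracket_linearr lmbracketxx lmbracket_jacobi.

Lemma lie_lmonom x y r s :
  [lie x ⊗X^ r, y ⊗X^ s] = [lie x, y] ⊗X^ (r + s).
Proof. exact: lmbracketE. Qed.

End LmonoidLie.

Section Restricted.
Context (K : fieldType) (p : nat) (L : lieAlgType K).
Implicit Types (x y : L).

(* In L ⊗ K[X] one has, in characteristic p,
     ad (x ⊗ X + y ⊗ 1) ^ (p - 1) (x ⊗ 1)
       = \sum_(1 <= i < p) i s_i(x, y) ⊗ X^(i - 1),
   and [jacobson_term i x y] is s_i(x, y). *)
Definition jacobson_term (i : nat) x y : L :=
  i%:R^-1 *: (iter p.-1 (lie_bracket (x ⊗X^ 1%N + y ⊗X^ 0%N : current L))
                (x ⊗X^ 0%N))@_(i.-1).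

(* [pm] is a p-th power map; the characteristic of K is meant to be p. *)
Definition restricted_structure (pm : L -> L) : Prop :=
  [/\ forall x y, [lie pm x, y] = iter p (lie_bracket x) y,
      forall (a : K) x, pm (a *: x) = a ^+ p *: pm x
    & forall x y,
        pm (x + y) = pm x + pm y + \sum_(1 <= i < p) jacobson_term i x y].

End Restricted.

Section Enveloping.
Context (K : fieldType) (L : lieAlgType K).

(* The free associative unital K-algebra on the underlying set of L. *)
Notation freeA := {malg K[{fmonom L}]}.
Definition free_gen (x : L) : freeA := << fmu x >>.

(* The first relations make [free_gen] linear, so that they turn the free
   algebra into the tensor algebra of L. *)
Definition envel_rel : set freeA :=
  [set w | (exists (a : K) x y,
       w = free_gen (a *: x + y) - (a *: free_gen x + free_gen y)) \/
     (exists x y, w = free_gen x * free_gen y - free_gen y * free_gen x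
                        - free_gen [lie x, y])].

Definition envel_ideal : set freeA := smallest (@two_sided_ideal freeA) envel_rel.

Definition envel_pred (w : freeA) : bool := `[< envel_ideal w >].

Lemma envel_idealP : two_sided_ideal envel_ideal.
Proof.
split=> [|u v hu hv|a u b hu] S [idS rS]; case: (idS) => S0 SB SM //.
  by apply: SB; [apply: hu | apply: hv].
by apply: SM; apply: hu.
Qed.

Lemma envel_zmod_closed : zmod_closed envel_pred.
Proof.
case: envel_idealP => I0 IB _; split; first exact/asboolP.
by move=> u v /asboolP hu /asboolP hv; apply/asboolP; apply: IB.
Qed.

HB.instance Definition _ :=
  GRing.isZmodClosed.Build freeA envel_pred envel_zmod_closed.

(* The universal enveloping algebra U(L). *)
Definition envel := {ideal_quot (GRing.ZmodClosed.clone freeA envel_pred _)}.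

HB.instance Definition _ := Choice.on envel.
HB.instance Definition _ := GRing.Zmodule.on envel.

Definition envel_pi (w : freeA) : envel := \pi_envel w.

Lemma envel_piP u v : reflect (envel_ideal (u - v)) (envel_pi u == envel_pi v).
Proof. by rewrite -Quotient.idealrBE; apply: asboolP. Qed.

Lemma envel_pi_repr (a : envel) : envel_pi (repr a) = a.
Proof. exact: reprK. Qed.

Lemma envel_piB u v : envel_pi (u - v) = envel_pi u - envel_pi v.
Proof. exact: (raddfB (\pi_envel)). Qed.

Lemma envel_piD u v : envel_pi (u + v) = envel_pi u + envel_pi v.
Proof. exact: (raddfD (\pi_envel)). Qed.

Lemma envel_idealD u v : envel_ideal u -> envel_ideal v -> envel_ideal (u + v).
Proof.
case: envel_idealP => I0 IB _ hu hv; rewrite -[v]opprK; apply: (IB) => //.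
by rewrite -sub0r; apply: IB.
Qed.

Lemma envel_idealM a u b : envel_ideal u -> envel_ideal (a * u * b).
Proof. by case: envel_idealP => _ _; apply. Qed.

Definition envel_one : envel := envel_pi 1.
Definition envel_mul (a b : envel) : envel := envel_pi (repr a * repr b).
Definition envel_scale (c : K) (a : envel) : envel := envel_pi (c *: repr a).

Lemma envel_reprP u : envel_ideal (u - repr (envel_pi u)).
Proof. by apply/envel_piP; rewrite envel_pi_repr. Qed.

Lemma envel_piM u v : envel_pi (u * v) = envel_mul (envel_pi u) (envel_pi v).
Proof.
apply/eqP/envel_piP; set u' := repr _; set v' := repr _.
have -> : u * v - u' * v' = 1 * (u - u') * v + u' * (v - v') * 1.
  by rewrite mul1r mulr1 mulrBl mulrBr addrA subrK.
by apply: envel_idealD; apply: envel_idealM; apply: envel_reprP.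
Qed.

Lemma envel_piZ c u : envel_pi (c *: u) = envel_scale c (envel_pi u).
Proof.
apply/eqP/envel_piP; rewrite -scalerBr -mul_malgC -[_ * _]mulr1.
by apply: envel_idealM; apply: envel_reprP.
Qed.

Lemma envel_one_neq0 : envel_one != 0.
Proof.
have -> : 0 = envel_pi 0 by rewrite -[0 in RHS]subr0 envel_piB subrr.
apply/negP => /envel_piP; rewrite subr0.
have mcoeff1M (u v : freeA) : (u * v)@_mone = u@_mone * v@_mone.
  exact: (rmorphM (mcoeff mone)).
pose S := [set w : freeA | w@_mone = 0].
have idS : two_sided_ideal S.
  split=> [|u v|a u b]; rewrite /S /= ?mcoeff0 //.
    by move=> hu hv; rewrite mcoeffB hu hv subr0.
  by move=> hu; rewrite mcoeff1M (mcoeff1M a) hu mulr0 mul0r.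
have gen0 x : (free_gen x)@_mone = 0.
  by rewrite mcoeffU; case: eqP => // /(congr1 (@fdeg _)); rewrite fdegU fdeg1.
have relS : envel_rel `<=` S.
  move=> w [[a [x [y ->]]]|[x [y ->]]]; rewrite /S /=.
    by rewrite mcoeffB mcoeffD mcoeffZ !gen0 mulr0 addr0 subr0.
  have coef3 (P Q R : freeA) : P@_mone = 0 -> Q@_mone = 0 -> R@_mone = 0 ->
    (P - Q - R)@_mone = 0 by rewrite !mcoeffB => -> -> ->; rewrite !subr0.
  by apply: coef3; [rewrite mcoeff1M gen0 mul0r | rewrite mcoeff1M gen0 mul0r | exact: gen0].
by move=> /(_ S (conj idS relS)); rewrite /S /= mcoeffU eqxx => /eqP; rewrite oner_eq0.
Qed.

Lemma envel_mulA : associative envel_mul.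
Proof.
move=> a b c; rewrite -[a]envel_pi_repr -[b]envel_pi_repr -[c]envel_pi_repr.
by rewrite -!envel_piM mulrA.
Qed.
Lemma envel_mul1r : left_id envel_one envel_mul.
Proof. by move=> a; rewrite -[a]envel_pi_repr -envel_piM mul1r. Qed.
Lemma envel_mulr1 : right_id envel_one envel_mul.
Proof. by move=> a; rewrite -[a]envel_pi_repr -envel_piM mulr1. Qed.
Lemma envel_mulDl : left_distributive envel_mul +%R.
Proof.
move=> a b c; rewrite -[a]envel_pi_repr -[b]envel_pi_repr -[c]envel_pi_repr.
by rewrite -envel_piD -!envel_piM mulrDl envel_piD.
Qed.
Lemma envel_mulDr : right_distributive envel_mul +%R.
Proof.
move=> a b c; rewrite -[a]envel_pi_repr -[b]envel_pi_repr -[c]envel_pi_repr.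
by rewrite -envel_piD -!envel_piM mulrDr envel_piD.
Qed.

HB.instance Definition _ := GRing.Zmodule_isNzRing.Build envel
  envel_mulA envel_mul1r envel_mulr1 envel_mulDl envel_mulDr envel_one_neq0.

Lemma envel_scaleA a b v : envel_scale a (envel_scale b v) = envel_scale (a * b) v.
Proof. by rewrite -[v]envel_pi_repr -!envel_piZ scalerA. Qed.
Lemma envel_scale1 : left_id 1 envel_scale.
Proof. by move=> v; rewrite -[v]envel_pi_repr -envel_piZ scale1r. Qed.
Lemma envel_scaleDr : right_distributive envel_scale +%R.
Proof.
move=> c u v; rewrite -[u]envel_pi_repr -[v]envel_pi_repr.
by rewrite -envel_piD -!envel_piZ scalerDr envel_piD.
Qed.
Lemma envel_scaleDl v : {morph envel_scale^~ v : a b / a + b}.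
Proof.
by move=> a b; rewrite -[v]envel_pi_repr -!envel_piZ scalerDl envel_piD.
Qed.

HB.instance Definition _ := GRing.Zmodule_isLmodule.Build K envel
  envel_scaleA envel_scale1 envel_scaleDr envel_scaleDl.

Lemma envel_scaleAl (c : K) (u v : envel) : c *: (u * v) = (c *: u) * v.
Proof.
rewrite -[u]envel_pi_repr -[v]envel_pi_repr.
rewrite -[_ * _]envel_piM -[LHS]envel_piZ -[_ *: envel_pi _]envel_piZ.
by rewrite -[RHS]envel_piM scalerAl.
Qed.

HB.instance Definition _ := GRing.Lmodule_isLalgebra.Build K envel envel_scaleAl.

Lemma free_scaleAr (c : K) (u v : freeA) : c *: (u * v) = u * (c *: v).
Proof.
apply/malgP => m; rewrite mcoeffZ.
rewrite [in LHS](mcoeffMlw m (fsubset_refl (msupp u)) (fsubset_refl (msupp v))).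
rewrite [in RHS](mcoeffMlw m (fsubset_refl (msupp u)) (msuppZ_le c v)).
rewrite mulr_sumr.
apply: eq_bigr => m1 _; rewrite mulr_sumr; apply: eq_bigr => m2 _.
by rewrite mcoeffZ mulrnAr mulrCA.
Qed.

Lemma envel_scaleAr (c : K) (u v : envel) : c *: (u * v) = u * (c *: v).
Proof.
rewrite -[u]envel_pi_repr -[v]envel_pi_repr.
rewrite -[_ * _]envel_piM -[LHS]envel_piZ -[_ *: envel_pi _]envel_piZ.
by rewrite -[RHS]envel_piM free_scaleAr.
Qed.

HB.instance Definition _ := GRing.Lalgebra_isAlgebra.Build K envel envel_scaleAr.

(* The canonical map L -> U(L). *)
Definition envel_in (x : L) : envel := envel_pi (free_gen x).

Lemma envel_in_linear : linear envel_in.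
Proof.
move=> a x y; apply/eqP.
rewrite -[_ *: envel_in x]envel_piZ -envel_piD; apply/envel_piP.
by move=> S [_]; apply; left; exists a, x, y.
Qed.

Lemma envel_in_lie x y : envel_in [lie x, y] = envel_in x * envel_in y - envel_in y * envel_in x.
Proof.
apply/esym/eqP; rewrite -[envel_in x * _]envel_piM -[envel_in y * _]envel_piM -envel_piB.
by apply/envel_piP => S [_]; apply; right; exists x, y.
Qed.

Section UniversalProperty.
Context (A : algType K).

Section Lift.
Variable f : L -> A.
Hypothesis f_lin : linear f.
Hypothesis f_lie : forall x y, f [lie x, y] = f x * f y - f y * f x.

Let fm (m : {fmonom L}) : A := \prod_(x <- (m : seq L)) f x.

Fact envel_fm_morph : mmorphism fm.
Proof.
by split=> [m1 m2|]; rewrite /fm ?fmM ?big_cat // fm1 big_nil.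
Qed.

HB.instance Definition _ := monalg.isMultiplicative.Build _ _ fm envel_fm_morph.

Let phi : freeA -> A := mmap (in_alg A) fm.

Fact envel_phiM u v : phi (u * v) = phi u * phi v.
Proof.
have comm (g : freeA) m m' : GRing.comm (in_alg A g@_m) (fm m').
  by rewrite /GRing.comm /= mulr_algl mulr_algr.
exact: (commr_mmap_is_multiplicative comm).1.
Qed.

Fact envel_phi1 : phi 1 = 1.
Proof. exact: mmap1. Qed.

Fact envel_phiZ c u : phi (c *: u) = c *: phi u.
Proof. by rewrite /phi mmapZ mulr_algl. Qed.

Fact envel_phiD u v : phi (u + v) = phi u + phi v.
Proof. exact: raddfD. Qed.

Fact envel_phiB u v : phi (u - v) = phi u - phi v.
Proof. exact: raddfB. Qed.

Fact envel_phi_gen x : phi (free_gen x) = f x.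
Proof. by rewrite /phi mmapU /= scale1r mul1r /fm fmU big_seq1. Qed.

Fact envel_phi_ker u : envel_ideal u -> phi u = 0.
Proof.
move=> /(_ [set w | phi w = 0]); apply.
split=> [|w [[a [x [y ->]]]|[x [y ->]]]] /=.
- split=> [|w w' /= hw hw'|a w b /= hw]; first exact: raddf0.
    by rewrite envel_phiB hw hw' subr0.
  by rewrite !envel_phiM hw mulr0 mul0r.
- by rewrite envel_phiB envel_phiD (envel_phiZ _ (free_gen x)) !envel_phi_gen f_lin subrr.
- have phiB3 (P Q R : freeA) : phi P - phi Q = phi R -> phi (P - Q - R) = 0.
    by rewrite 2!envel_phiB => ->; rewrite subrr.
  apply: phiB3; rewrite (envel_phi_gen [lie x, y]) f_lie.
  have phi2 a b : phi (free_gen a * free_gen b) = f a * f b.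
    by rewrite envel_phiM (envel_phi_gen a) (envel_phi_gen b).
  by congr (_ - _).
Qed.

Lemma envel_lift : exists F : envel -> A,
  [/\ linear F, monoid_morphism F & forall x, F (envel_in x) = f x].
Proof.
pose F (a : envel) : A := phi (repr a); exists F.
have FE w : F (envel_pi w) = phi w.
  apply/esym/eqP; rewrite -subr_eq0 -envel_phiB; apply/eqP/envel_phi_ker.
  exact: envel_reprP.
split=> [a u v| |x]; last by rewrite FE envel_phi_gen.
  rewrite -[u]envel_pi_repr -[v]envel_pi_repr -[_ *: _]envel_piZ -envel_piD.
  by rewrite !FE envel_phiD envel_phiZ.
split=> [|u v]; first by rewrite -[1]/(envel_pi 1) FE envel_phi1.
rewrite -[u]envel_pi_repr -[v]envel_pi_repr -[_ * _]envel_piM.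
by rewrite !FE envel_phiM.
Qed.

End Lift.

Lemma envel_lift_unique (F G : envel -> A) :
    linear F -> monoid_morphism F -> linear G -> monoid_morphism G ->
  (forall x, F (envel_in x) = G (envel_in x)) -> F =1 G.
Proof.
move=> Fl [F1 FM] Gl [G1 GM] FG a; rewrite -[a]envel_pi_repr.
have lin0 (H : envel -> A) : linear H -> H 0 = 0.
  by move=> /(_ (-1) 0 0); rewrite scaler0 addr0 scaleN1r addNr.
have monE (m : {fmonom L}) : F (envel_pi << m >>) = G (envel_pi << m >>).
  case: m => s; elim: s => [|x s IH].
    have -> : envel_pi << FMonom [::] >> = 1 by rewrite -fmoneE.
    by rewrite F1 G1.
  have -> : << FMonom (x :: s) >> = free_gen x * << FMonom s >> :> freeA.
    apply/malgP => m; rewrite /free_gen; congr (_@_m).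
    rewrite malgM_def fgmulUU mulr1; congr << _ *g _ >>.
    by apply/eqP; rewrite -val_eqE /= fmM fmU.
  rewrite (envel_piM (free_gen x)) -[envel_mul _ _]/(envel_in x * _).
  by rewrite FM GM FG IH.
rewrite [repr a]monalgE.
elim: (enum_fset _) => [|m s IH].
  have -> : envel_pi (\sum_(k <- [::]) << (repr a)@_k *g k >>) = 0.
    by rewrite big_nil -[0 in LHS](subrr 0) envel_piB subrr.
  by rewrite !lin0.
rewrite big_cons.
have UE c : << c *g m >> = c *: << m >> :> freeA.
  by rewrite -mul_malgC malgM_def fgmulUU mulr1 mul1m.
have piE c u : envel_pi (c *: << m >> + u)
    = c *: envel_pi << m >> + envel_pi u :> envel.
  have <- : envel_pi (c *: << m >>) = c *: envel_pi << m >> by exact: envel_piZ.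
  exact: envel_piD.
by rewrite UE piE Fl Gl monE IH.
Qed.

End UniversalProperty.

End Enveloping.

(* Main.v *)
(* The enveloping algebra U(g) is filtered with gr U(g) = S(g) by the
   Poincare-Birkhoff-Witt theorem, which is proved here by letting g act on
   S(g) = K[z_j] with x_j . z_M = z_j z_M whenever j <= M; the map
   a |-> a . 1 is then a linear isomorphism from U(g) to S(g).
   The symbol f of a central element is annihilated by all derivations
   D_y of S(g) extending ad y.  Let m be a monomial and let z_t be a variable
   that occurs neither in f nor in m.  The coefficient of z_t m in D_y f is the
   t-th coordinate of [y, v], where v in g is the vector whose coordinates are
   the coefficients of m in the partial derivatives of f.  When [g, v] has
   infinite dimension for all v <> 0, as in l (x) K[M] for l centerless and M
   infinite and cancellative, it follows that v = 0.  All partial derivatives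
   of f are then 0, so that f is a polynomial in the z_j^p, which are the
   symbols of the central elements x_j^p - x_j^[p]; induction on the degree
   concludes. *)

Require Import Defs.
From HB Require Import structures.
From mathcomp Require Import all_boot all_order all_algebra finmap monalg.
From mathcomp Require Import boolp classical_sets.
From mathcomp Require Import ring wochoice.
Import GRing.Theory.
Local Open Scope ring_scope.

Set Implicit Arguments.
Unset Strict Implicit.
Unset Printing Implicit Defensive.

(** * Linear extension *)

HB.lock Definition lext (K : fieldType) (T : choiceType) (V : lmodType K)
    (f : T -> V) (u : {malg K[T]}) : V :=
  \sum_(m <- msupp u) u@_m *: f m.
Arguments lext {K T V} f u.

(* The monomial [<< m >>] is locked: when the exponents [m] are themselves
   finitely supported functions, failing conversion tests unfold it at an
   exponential cost. *)
HB.lock Definition zmon (K : fieldType) (T : choiceType) (m : T) : {malg K[T]} :=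
  << m >>.
Arguments zmon {K T} m.

Notation "''z_' m" := (zmon m) (at level 8, m at level 2, format "''z_' m").

Section LinearExtension.
Context (K : fieldType).

Section Monomials.
Context (T : choiceType).

Lemma zmonE (m : T) : 'z_m = << m >> :> {malg K[T]}.
Proof. by rewrite zmon.unlock. Qed.

Lemma mcoeff_z (m k : T) : ('z_m : {malg K[T]})@_k = (m == k)%:R.
Proof. by rewrite zmonE mcoeffU. Qed.

Lemma msupp_z (m : T) : msupp ('z_m : {malg K[T]}) = [fset m]%fset.
Proof. by rewrite zmonE msuppU oner_eq0. Qed.

End Monomials.

Section Extension.
Context (T : choiceType) (V : lmodType K).
Implicit Types (f : T -> V) (u : {malg K[T]}).

Lemma lextE f u : lext f u = \sum_(m <- msupp u) u@_m *: f m.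
Proof. by rewrite lext.unlock. Qed.

Lemma lextEw (d : {fset T}) f u : (msupp u `<=` d)%fset ->
  lext f u = \sum_(m <- d) u@_m *: f m.
Proof.
move=> le; rewrite lextE; apply: (big_fset_incl _ le) => m _ /mcoeff_outdom ->.
by rewrite scale0r.
Qed.

Lemma lext_is_linear f : linear (lext f).
Proof.
move=> a u v; pose d := (msupp u `|` msupp v)%fset.
have le : (msupp (a *: u + v) `<=` d)%fset.
  apply: fsubset_trans (msuppD_le _ _) _.
  by rewrite fsetUSS ?fsubset_refl ?msuppZ_le.
rewrite (lextEw f le) (lextEw f (fsubsetUl _ (msupp v))).
rewrite (lextEw f (fsubsetUr (msupp u) _)) scaler_sumr -big_split /=.
by apply: eq_bigr => m _; rewrite mcoeffD mcoeffZ scalerDl scalerA.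
Qed.

HB.instance Definition _ f :=
  GRing.isLinear.Build K {malg K[T]} V _ (lext f) (lext_is_linear f).

Lemma lextU f m : lext f 'z_m = f m.
Proof. by rewrite lextE msupp_z big_seq_fset1 mcoeff_z eqxx scale1r. Qed.

Lemma eq_lext f g u : {in msupp u, f =1 g} -> lext f u = lext g u.
Proof.
by move=> fg; rewrite !lextE !big_seq; apply: eq_bigr => m mu; rewrite fg.
Qed.

Lemma lext_linear_fun a f g u :
  lext (fun m => a *: f m + g m) u = a *: lext f u + lext g u.
Proof.
rewrite !lextE scaler_sumr -big_split /=.
by apply: eq_bigr => m _; rewrite scalerDr !scalerA mulrC.
Qed.

Lemma malg_ind (P : {malg K[T]} -> Prop) :
  P 0 -> (forall a m u, P u -> P (a *: 'z_m + u)) -> forall u, P u.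
Proof.
move=> P0 PD u; rewrite [u]monalgE.
elim: (enum_fset _) => [|m s IH]; first by rewrite big_nil.
have -> : \sum_(k <- m :: s) << u@_k *g k >>
    = u@_m *: 'z_m + \sum_(k <- s) << u@_k *g k >>.
  rewrite big_cons; congr (_ + _); apply/malgP => k.
  by rewrite mcoeffZ mcoeff_z mcoeffU mulrnAr mulr1.
exact: PD.
Qed.

End Extension.

Lemma linear_lext (T : choiceType) (V W : lmodType K) (h : {linear V -> W})
    (f : T -> V) u : h (lext f u) = lext (h \o f) u.
Proof. by rewrite !lextE linear_sum; apply: eq_bigr => m _; rewrite linearZ. Qed.

Lemma lext_malg (T : choiceType) (u : {malg K[T]}) : lext (fun m => 'z_m) u = u.
Proof.
rewrite lextE [RHS]monalgE; apply: eq_bigr => m _.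
by apply/malgP => k; rewrite mcoeffZ mcoeff_z mcoeffU mulrnAr mulr1.
Qed.

Lemma mcoeff_lext (T T' : choiceType) (f : T -> {malg K[T']}) u k :
  (lext f u)@_k = \sum_(m <- msupp u) u@_m * (f m)@_k.
Proof.
rewrite lextE (big_morph (mcoeff k) (mcoeffD k) (mcoeff0 k)).
by apply: eq_bigr => m _; rewrite mcoeffZ.
Qed.

Section Subspaces.
Context (V : lmodType K) (W : set V) (W_sub : is_subspace W).

Lemma subspaceD u v : W u -> W v -> W (u + v).
Proof. by case: W_sub => _ h wu wv; rewrite -[u]scale1r; apply: h. Qed.

Lemma subspaceZ a u : W u -> W (a *: u).
Proof. by case: W_sub => h0 h wu; rewrite -[a *: u]addr0; apply: h. Qed.

Lemma subspaceN u : W u -> W (- u).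
Proof. by rewrite -scaleN1r; apply: subspaceZ. Qed.

Lemma subspaceB u v : W u -> W v -> W (u - v).
Proof. by move=> ? ?; apply: subspaceD => //; apply: subspaceN. Qed.

Lemma subspace_sum (I : eqType) (s : seq I) (P : pred I) (f : I -> V) :
  (forall i, i \in s -> P i -> W (f i)) -> W (\sum_(i <- s | P i) f i).
Proof.
move=> h; rewrite big_seq_cond; elim/big_ind: _; first by case: W_sub.
  exact: subspaceD.
by move=> i /andP[]; apply: h.
Qed.

Lemma subspace_lext (T : choiceType) (f : T -> V) (u : {malg K[T]}) :
  (forall m, m \in msupp u -> W (f m)) -> W (lext f u).
Proof.
move=> h; rewrite lextE; apply: subspace_sum => m mu _.
by apply: subspaceZ; apply: h.
Qed.

End Subspaces.

Lemma linear_span_subspace (V : lmodType K) (S : set V) :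
  is_subspace (linear_span S).
Proof.
split=> [W [[] //]|a u v hu hv W [W_sub SW]].
by case: (W_sub) => _; apply; [apply: hu | apply: hv].
Qed.

(** [lext b] is injective because a finitely supported family is a finite one indexed by its
    support, and surjective because its image is a subspace containing the basis. The chosen inverse
    is linear by uniqueness of coordinates. *)
Lemma basis_coordinates (V : lmodType K) (T : choiceType) (b : T -> V) :
  is_basis b -> exists c : V -> {malg K[T]},
    [/\ linear c, cancel c (lext b) & forall j, c (b j) = 'z_j].
Proof.
move=> [free span].
have inj u : lext b u = 0 -> u = 0.
  move=> u0; apply/malgP => m; rewrite mcoeff0.
  have [mu|/mcoeff_outdom//] := boolP (m \in msupp u).
  pose s := enum_fset (msupp u).
  have mI : (index m s < size s)%N by rewrite index_mem.
  have := @free (size s) (fun k => nth m s k) (fun k => u@_(nth m s k)).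
  move=> /(_ _ _ (Ordinal mI)) /=; rewrite nth_index //; apply.
    by move=> i j /eqP; rewrite nth_uniq ?ltn_ord ?fset_uniq // => /eqP/val_inj.
  by rewrite -[RHS]u0 lextE [RHS](big_nth m) big_mkord.
have surj x : exists u, lext b u = x.
  have /(_ [set x | exists u, lext b u = x]%classic) : linear_span (range b) x.
    by rewrite span.
  apply; split; first split.
  - by exists 0; rewrite linear0.
  - by move=> a _ _ [u <-] [v <-]; exists (a *: u + v); rewrite linearP.
  - by move=> _ [j _ <-]; exists 'z_j; rewrite lextU.
have [c cK] := choice surj.
have c_eq x u : lext b u = x -> c x = u.
  move=> ux; apply/eqP; rewrite -subr_eq0; apply/eqP/inj.
  by rewrite linearB /= cK ux subrr.
exists c; split=> // [a x y|j]; apply: c_eq; last exact: lextU.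
by rewrite linearP /= !cK.
Qed.

End LinearExtension.

Section LieBracketComplements.
Context (K : fieldType) (L : lieAlgType K).
Implicit Types (x y z : L).

HB.instance Definition _ x :=
  GRing.isLinear.Build K L L _ (lie_bracket x) (lie_linearr x).

Lemma lieC x y : [lie x, y] = - [lie y, x].
Proof. by apply/eqP; rewrite -addr_eq0 lie_anti. Qed.

Lemma lie_jacobiE x y z :
  [lie x, [lie y, z]] = [lie [lie x, y], z] + [lie y, [lie x, z]].
Proof.
have := lie_jacobi x y z; rewrite [[lie z, [lie x, y]]]lieC [[lie z, x]]lieC.
rewrite linearN /= => /eqP; rewrite subr_eq0 subr_eq => /eqP ->.
by rewrite addrC.
Qed.

End LieBracketComplements.

(** * Modules over the enveloping algebra *)

Section EnvelopingModules.
Context (K : fieldType) (L : lieAlgType K).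

Section Lift.
Context (V : lmodType K) (act : L -> V -> V).
Hypothesis act_linearl : forall v, linear (act^~ v).
Hypothesis act_linearr : forall x, linear (act x).
Hypothesis act_lie : forall x y v,
  act [lie x, y] v = act x (act y v) - act y (act x v).

(** A word of the free algebra acts by applying its letters from right to left. The elements acting
    as zero form a two-sided ideal containing the defining relations of U(L), so the action descends
    to the quotient. *)
Lemma envel_module : exists F : envel L -> V -> V,
  [/\ forall v, linear (F^~ v), forall a, linear (F a), forall v, F 1 v = v,
      forall a b v, F (a * b) v = F a (F b v)
    & forall x v, F (envel_in x) v = act x v].
Proof.
pose wact (m : {fmonom L}) v := foldr act v (m : seq L).
have wact_lin m : linear (wact m).
  rewrite /wact => a u v; elim: (m : seq L) => //= x s ->.
  by rewrite act_linearr.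
pose tact (t : {malg K[{fmonom L}]}) v := lext (wact^~ v) t.
have tact_lin t : linear (tact t).
  move=> a u v; rewrite /tact -lext_linear_fun.
  by apply: eq_lext => m _; apply: wact_lin.
have tact0 t : tact t 0 = 0.
  by have := tact_lin t (-1) 0 0; rewrite scaler0 addr0 scaleN1r addNr.
have tactP c t t' v : tact (c *: t + t') v = c *: tact t v + tact t' v.
  by rewrite /tact linearP.
have tact0l v : tact 0 v = 0 by rewrite /tact linear0.
have tactBl t t' v : tact (t - t') v = tact t v - tact t' v.
  by rewrite /tact linearB.
have tactU m v : tact 'z_m v = wact m v by rewrite /tact lextU.
have tactUM m t v : tact ('z_m * t) v = wact m (tact t v).
  elim/malg_ind: t => [|a m' t IH].
    rewrite mulr0 !tact0l.
    by have := wact_lin m (-1) 0 0; rewrite scaler0 addr0 scaleN1r addNr.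
  rewrite mulrDr -free_scaleAr !tactP IH wact_lin; congr (a *: _ + _).
  by rewrite zmonE zmonE malgM_def fgmulUU mulr1 -!zmonE !tactU /wact fmM foldr_cat.
have tactM t t' v : tact (t * t') v = tact t (tact t' v).
  elim/malg_ind: t => [|a m t IH]; first by rewrite mul0r !tact0l.
  by rewrite mulrDl -scalerAl !tactP IH tactUM tactU.
have tact_gen x v : tact (free_gen x) v = act x v.
  by rewrite /free_gen -zmonE tactU /wact fmU.
have tact_ideal w v : envel_ideal w -> tact w v = 0.
  move=> /(_ [set w | forall v, tact w v = 0]%classic) h; move: v; apply: h.
  split=> [|{}w [[a [x [y ->]]]|[x [y ->]]] v] /=.
  - split=> [v|u u' /= hu hu' v|t u t' /= hu v] //=.
      by rewrite tactBl hu hu' subr0.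
    by rewrite !tactM hu tact0.
  - by rewrite tactBl tactP !tact_gen act_linearl subrr.
  - by rewrite 2!tactBl !tactM !tact_gen act_lie subrr.
pose F (a : envel L) v := tact (repr a) v.
have FE w v : F (envel_pi w) v = tact w v.
  by apply/esym/eqP; rewrite -subr_eq0 -tactBl tact_ideal //; apply: envel_reprP.
exists F; split=> [v c a a'|a c u v|v|a a' v|x v].
- rewrite -[a]envel_pi_repr -[a']envel_pi_repr -[_ *: _]envel_piZ -envel_piD.
  by rewrite !FE tactP.
- exact: tact_lin.
- by rewrite -[1]/(envel_pi 1) FE -[1]/<< mone >> -zmonE tactU /wact fm1.
- rewrite -[a]envel_pi_repr -[a']envel_pi_repr -[_ * _]envel_piM !FE.
  exact: tactM.
- by rewrite FE tact_gen.
Qed.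

End Lift.

(** Induction on words: U(L) is spanned by products of elements of L, which are built one factor at
    a time on the left. *)
Lemma envel_ind (P : set (envel L)) : is_subspace P -> P 1 ->
  (forall x a, P a -> P (envel_in x * a)) -> forall a, P a.
Proof.
move=> P_sub P1 PM a; rewrite -[a]envel_pi_repr.
elim/malg_ind: (repr a) => [|c m u IH].
  have -> : envel_pi 0 = 0 :> envel L by rewrite -(subrr 0) envel_piB subrr.
  by case: P_sub.
case: (P_sub) => _ h; rewrite envel_piD envel_piZ; apply: h => // {u IH}.
rewrite zmonE; case: m => s; elim: s => [|x s IH].
  by have <- : (1 : envel L) = envel_pi << FMonom [::] >> by rewrite -fmoneE.
have -> : << FMonom (x :: s) >> = free_gen x * << FMonom s >>
    :> {malg K[{fmonom L}]}.
  apply/malgP => m; congr (_@_m); rewrite /free_gen malgM_def fgmulUU mulr1.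
  by congr << _ *g _ >>; apply/eqP; rewrite -val_eqE /= fmM fmU.
by rewrite envel_piM; apply: PM.
Qed.

HB.instance Definition _ :=
  GRing.isLinear.Build K L (envel L) _ (@envel_in K L) (@envel_in_linear K L).

End EnvelopingModules.

(** * Monomials and the degree filtration of S(g) *)

HB.lock Definition consm (J : choiceType) (j : J) (M : {cmonom J}) : {cmonom J} :=
  mmul (ucm j) M.

Notation "j ⊙ M" := (consm j M) (at level 35, right associativity).

Section Monomials.
Context (J : choiceType).
Implicit Types (i j k : J) (M N : {cmonom J}).

Lemma consmE k N i : (k ⊙ N) i = ((k == i) + N i)%N.
Proof. by rewrite consm.unlock cmM cmU. Qed.

Lemma consmCA j k N : j ⊙ k ⊙ N = k ⊙ j ⊙ N.
Proof. by apply/eqP/cmP => i; rewrite !consmE addnCA. Qed.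

Lemma consmK k N : divcm (k ⊙ N) (ucm k) = N.
Proof. by apply/eqP/cmP => i; rewrite divcmE consmE cmU addKn. Qed.

Lemma consmI k : injective (consm k).
Proof. by move=> M N eqMN; rewrite -(consmK k M) eqMN consmK. Qed.

Lemma divcmK k M : k \in finsupp M -> k ⊙ divcm M (ucm k) = M.
Proof.
rewrite -cmE_neq0 => Mk; apply/eqP/cmP => i; rewrite consmE divcmE cmU.
by case: eqP => [<-|_] /=; rewrite ?subn0 // subnKC // lt0n.
Qed.

Lemma mdegU_cons k N : mdeg (k ⊙ N) = (mdeg N).+1.
Proof. by rewrite consm.unlock mdegM mdegU. Qed.

Lemma cons_finsupp k N i : (i \in finsupp (k ⊙ N)) = (i == k) || (i \in finsupp N).
Proof. by rewrite consm.unlock mdomD mdomU in_fsetU in_fset1. Qed.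

Context (le : rel J).
Hypotheses (le_total : total le) (le_trans : transitive le)
  (le_anti : antisymmetric le).

(** The condition j <= M under which x_j . z_M = z_j z_M; it is vacuous for M = 1. *)
Definition below j M := all (le j) (finsupp M).

Lemma le_refl j : le j j.
Proof. by have := le_total j j; rewrite orbb. Qed.

Lemma below_cons j k N : below j (k ⊙ N) = le j k && below j N.
Proof.
apply/allP/andP => [h|[jk /allP h] i]; last first.
  by rewrite cons_finsupp => /orP[/eqP->//|/h].
split; first by apply: h; rewrite cons_finsupp eqxx.
by apply/allP => i iN; apply: h; rewrite cons_finsupp iN orbT.
Qed.

Lemma below_trans j k N : le j k -> below k N -> below j N.
Proof. by move=> jk /allP h; apply/allP => i /h; apply: le_trans. Qed.

Lemma below1 j : below j mone.
Proof. by rewrite /below mdom1. Qed.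

(** Strong induction on the degree, splitting off the least variable, which sorting the support
    finds. The induction hypothesis covers every monomial of degree at most that of N because
    bracket terms bring in monomials other than z_N. *)
Lemma cmonom_min_ind (P : {cmonom J} -> Prop) : P mone ->
  (forall k N, below k N -> (forall M, (mdeg M <= mdeg N)%N -> P M) ->
     P (k ⊙ N)) ->
  forall M, P M.
Proof.
move=> P1 PS M; elim: {M}(mdeg M).+1 {-2}M (leqnn (mdeg M).+1) => // n IH M Mn.
have [M1|] := eqVneq (mdeg M) 0%N; first by rewrite (mdeg_eq0I M1).
rewrite mdeg_eq0 => M1.
have [k kM kmin] : exists2 k, k \in finsupp M & below k M.
  have : sort le (finsupp M) != [::].
    apply: contra M1 => /eqP s0; apply/eqP/eqP/cmP => i; rewrite cm1.
    by apply/eqP; rewrite cmE_eq0 -(mem_sort le) s0.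
  have := sort_sorted le_total (finsupp M).
  case: (sort le _) (mem_sort le (finsupp M)) => // k s sM ks _.
  exists k; first by rewrite -sM mem_head.
  apply/allP => i; rewrite -sM in_cons => /orP[/eqP->|]; first exact: le_refl.
  by move: ks; rewrite /= path_sortedE // => /andP[/allP h _] /h.
rewrite -(divcmK kM) in Mn kmin *; rewrite mdegU_cons in Mn.
apply: PS => [|M' M'N]; first by move: kmin; rewrite below_cons => /andP[].
by apply: IH; apply: leq_ltn_trans M'N _.
Qed.

(** The least variable of M for a total order; [None] stands for M = 1. *)
Definition hdm M : option J := ohead [seq k <- finsupp M | below k M].

Lemma hdm1 : hdm mone = None.
Proof. by rewrite /hdm mdom1. Qed.

Lemma hdm_cons k N : below k N -> hdm (k ⊙ N) = Some k.
Proof.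
move=> kN; rewrite /hdm; set s := [seq _ <- _ | _].
have ks : k \in s.
  by rewrite mem_filter below_cons le_refl kN cons_finsupp eqxx.
have s_eq i : i \in s -> i = k.
  rewrite mem_filter below_cons => /andP[/andP[ik _]].
  rewrite cons_finsupp => /orP[/eqP//|iN]; apply: le_anti; rewrite ik.
  by move/allP: kN => ->.
by case: s ks s_eq => // i s _ /(_ i (mem_head _ _)) /= ->.
Qed.

End Monomials.

Section DegreeFiltration.
Context (K : fieldType) (J : choiceType).
Local Notation S := {malg K[{cmonom J}]}.
Implicit Types (u v : S) (M N : {cmonom J}).

(** Elements of degree less than n. The strict bound makes [slt 0] the zero subspace, so that zero
    needs no convention on its degree. *)
Variant slt n u : Prop := Slt of (forall m, (n <= mdeg m)%N -> u@_m = 0).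

Lemma slt_coef n u : slt n u -> forall m, (n <= mdeg m)%N -> u@_m = 0.
Proof. by case. Qed.

Lemma slt_subspace n : is_subspace (slt n).
Proof.
split=> [|a u v [hu] [hv]]; split=> m nm; first exact: mcoeff0.
by rewrite mcoeffD mcoeffZ hu // hv // mulr0 addr0.
Qed.

Lemma sltP n a u v : slt n u -> slt n v -> slt n (a *: u + v).
Proof. by case: (slt_subspace n) => _; apply. Qed.

Lemma sltD n u v : slt n u -> slt n v -> slt n (u + v).
Proof. exact: (subspaceD (slt_subspace n)). Qed.

Lemma sltN n u : slt n u -> slt n (- u).
Proof. exact: (subspaceN (slt_subspace n)). Qed.

Lemma sltB n u v : slt n u -> slt n v -> slt n (u - v).
Proof. exact: (subspaceB (slt_subspace n)). Qed.

Lemma slt_0 n : slt n 0.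
Proof. by case: (slt_subspace n). Qed.

Lemma slt_msupp n u M : slt n u -> M \in msupp u -> (mdeg M < n)%N.
Proof.
by case=> hu; rewrite ltnNge; apply: contraL => /hu/eqP; rewrite mcoeff_eq0.
Qed.

Lemma sltW n n' u : (n <= n')%N -> slt n u -> slt n' u.
Proof. by move=> nn' [hu]; split=> m n'm; apply: hu; apply: leq_trans n'm. Qed.

Lemma sltU n M : (mdeg M < n)%N -> slt n 'z_M.
Proof.
by move=> Mn; split=> m nm; rewrite mcoeff_z; case: eqP Mn nm => // ->; case: ltnP.
Qed.

Lemma slt_lext (T : choiceType) n (f : T -> S) (u : {malg K[T]}) :
  (forall m, m \in msupp u -> slt n (f m)) -> slt n (lext f u).
Proof. exact: (subspace_lext (slt_subspace n)). Qed.

Lemma slt0_eq0 u : slt 0 u -> u = 0.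
Proof. by case=> hu; apply/malgP => m; rewrite hu ?mcoeff0. Qed.

End DegreeFiltration.

(** * The action of g on S(g) *)

Lemma commutator_mul (R : nzRingType) (x y w : R) :
  y * (x * w) + (x * y - y * x) * w = x * (y * w).
Proof. by rewrite mulrBl !mulrA addrC subrK. Qed.

Lemma commutatorP (K : fieldType) (A : algType K) (x u v : A) (a : K) :
  x * (a *: u + v) - (a *: u + v) * x = a *: (x * u - u * x) + (x * v - v * x).
Proof.
by rewrite mulrDr mulrDl -scalerAr -scalerAl opprD addrACA -scalerBr.
Qed.

Section Coordinates.
Context (K : fieldType) (L : lieAlgType K) (J : choiceType) (b : J -> L).
Context (crd : {linear L -> {malg K[J]}}).
Hypothesis crdK : cancel crd (lext b).
Local Notation S := {malg K[{cmonom J}]}.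

Lemma basis_ind (P : L -> Prop) :
  P 0 -> (forall a j x, P x -> P (a *: b j + x)) -> forall x, P x.
Proof.
move=> P0 PD x; rewrite -[x]crdK.
elim/malg_ind: (crd x) => [|a j u IH]; first by rewrite linear0.
by rewrite linearP /= lextU; apply: PD.
Qed.

(* The product x z_M in S(L). *)
Definition smul x M : S := lext (fun j => 'z_(j ⊙ M)) (crd x).

Lemma smul_slt x M : slt (mdeg M).+2 (smul x M).
Proof. by apply: slt_lext => j _; apply: sltU; rewrite mdegU_cons. Qed.

End Coordinates.

Section PBWAction.
Context (K : fieldType) (L : lieAlgType K) (J : choiceType) (b : J -> L).
Context (crd : {linear L -> {malg K[J]}}).
Hypotheses (crdK : cancel crd (lext b)) (crdb : forall j, crd (b j) = 'z_j).
Context (le : rel J).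
Hypotheses (le_total : total le) (le_trans : transitive le)
  (le_anti : antisymmetric le).
Local Notation S := {malg K[{cmonom J}]}.
Local Notation below := (below le).
Local Notation hdm := (hdm le).
Implicit Types (x y : L) (i j k : J) (M N : {cmonom J}) (u v : S).

(** [f M j] prescribes x_j . z_M, and this is its bilinear extension to L and S(L). *)
Definition mact (f : {cmonom J} -> J -> S) x u : S :=
  lext (fun j => lext (f^~ j) u) (crd x).

Lemma mact_linearl f u : linear (mact f ^~ u).
Proof. by move=> c x y; rewrite /mact !linearP. Qed.

Lemma mact_linearr f x : linear (mact f x).
Proof.
move=> c u v; apply: etrans (lext_linear_fun _ _ _ _).
by apply: eq_lext => j _; rewrite linearP.
Qed.

Lemma mactE f j M : mact f (b j) 'z_M = f M j.
Proof. by rewrite /mact crdb !lextU. Qed.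

Lemma eq_mact f g x u : (forall M j, M \in msupp u -> f M j = g M j) ->
  mact f x u = mact g x u.
Proof.
by move=> eq_a; apply: eq_lext => j _; apply: eq_lext => M Mu; apply: eq_a.
Qed.

(* [pact n M j] is x_j . z_M, computed with fuel [n]; the value is meaningful
   when [mdeg M <= n].  If k is the least variable of M = k N and k < j, then
   the action must satisfy x_j x_k z_N = x_k x_j z_N + [x_j, x_k] z_N, and
   since x_j z_N = z_j z_N + (terms of degree at most that of N), this
   determines x_j z_M from the action in lower degrees. *)
Fixpoint pact n M j : S :=
  if (n, hdm M) is (n'.+1, Some k) then
    if le j k then 'z_(j ⊙ M) else
      let N := divcm M (ucm k) in
      'z_(j ⊙ M) + mact (pact n') (b k) (pact n' N j - 'z_(j ⊙ N))
        + mact (pact n') [lie b j, b k] 'z_N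
  else 'z_(j ⊙ M).

Lemma pact_below n M j : below j M -> pact n M j = 'z_(j ⊙ M).
Proof.
case: n => [|n] //=; elim/(cmonom_min_ind le_total le_trans): M => [|k N kN _].
  by rewrite hdm1.
by rewrite hdm_cons // below_cons // => /andP[->].
Qed.

Lemma pact_cons n k N j : below k N -> ~~ le j k ->
  pact n.+1 (k ⊙ N) j = 'z_(j ⊙ k ⊙ N)
    + mact (pact n) (b k) (pact n N j - 'z_(j ⊙ N))
    + mact (pact n) [lie b j, b k] 'z_N.
Proof. by move=> kN /negbTE jk /=; rewrite hdm_cons // jk consmK. Qed.

(** The two claims are proved together: by the degree bound for N, the recursive calls of [pact]
    only meet monomials of degree at most that of N, where the fuel is already known to suffice. *)
Lemma pact_slt n M j : (mdeg M <= n)%N ->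
  slt (mdeg M).+1 (pact n M j - 'z_(j ⊙ M)) /\ pact n.+1 M j = pact n M j.
Proof.
elim: n M j => [|n IH] M j.
  rewrite leqn0 mdeg_eq0 => /eqP ->; rewrite !pact_below ?below1 // subrr.
  by split=> //; apply: slt_0.
elim/(cmonom_min_ind le_total le_trans): M => [|k N kN _].
  by rewrite !pact_below ?below1 // subrr; split=> //; apply: slt_0.
rewrite mdegU_cons ltnS => Nn.
have [jk|jk] := boolP (le j k).
  have jN := below_trans le_trans jk kN.
  rewrite !pact_below ?below_cons ?jk // subrr.
  by split=> //; apply: slt_0.
have [r_slt pactE] := IH N j Nn.
split; last first.
  have mactE' x u : slt (mdeg N).+1 u -> mact (pact n.+1) x u = mact (pact n) x u.
    move=> u_slt; apply: eq_mact => M' i /(slt_msupp u_slt); rewrite ltnS => M'N.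
    by case: (IH M' i (leq_trans M'N Nn)).
  rewrite (pact_cons n.+1 kN jk) (pact_cons n kN jk) pactE !mactE' //.
  exact: sltU.
have mact_slt x u : slt (mdeg N).+1 u -> slt (mdeg N).+2 (mact (pact n) x u).
  move=> u_slt; apply: slt_lext => i _; apply: slt_lext => M' /(slt_msupp u_slt).
  rewrite ltnS => M'N; have [h _] := IH M' i (leq_trans M'N Nn).
  rewrite -[pact _ _ _](subrK 'z_(i ⊙ M')); apply: sltD.
    by apply: sltW h; rewrite ltnW.
  by apply: sltU; rewrite mdegU_cons ltnS.
have subE (A B C : S) : A + B + C - A = B + C by rewrite addrAC [A + B]addrC addrK.
rewrite (pact_cons n kN jk) subE.
by apply: sltD; apply: mact_slt => //; apply: sltU.
Qed.

Lemma pact_stable n M j : (mdeg M <= n)%N -> pact n M j = pact (mdeg M) M j.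
Proof.
move=> Mn; rewrite -(subnKC Mn); elim: (n - _)%N => [|d IH]; first by rewrite addn0.
by rewrite addnS -IH; case: (pact_slt j (leq_addr d (mdeg M))).
Qed.

(** Fuel [mdeg M] suffices by [pact_stable]. *)
Definition pbw x u : S := mact (fun M j => pact (mdeg M) M j) x u.

HB.instance Definition _ x :=
  GRing.isLinear.Build K S S _ (pbw x) (mact_linearr _ x).

Lemma pbw_linearl u : linear (pbw^~ u).
Proof. exact: mact_linearl. Qed.

Lemma pbwPl a x y u : pbw (a *: x + y) u = a *: pbw x u + pbw y u.
Proof. exact: pbw_linearl. Qed.

Lemma pbwDl x y u : pbw (x + y) u = pbw x u + pbw y u.
Proof. by have := pbw_linearl u 1 x y; rewrite /= !scale1r. Qed.

Lemma pbw0l u : pbw 0 u = 0.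
Proof. by have := pbw_linearl u (-1) 0 0; rewrite scaler0 addr0 scaleN1r addNr. Qed.

Lemma pbwNl x u : pbw (- x) u = - pbw x u.
Proof. by have := pbw_linearl u (-1) x 0; rewrite pbw0l !addr0 !scaleN1r. Qed.

Lemma pbwE j M : pbw (b j) 'z_M = pact (mdeg M) M j.
Proof. exact: mactE. Qed.

Lemma mact_pbw n x u : slt n.+1 u -> mact (pact n) x u = pbw x u.
Proof.
move=> u_slt; apply: eq_mact => M i /(slt_msupp u_slt); rewrite ltnS => Mn.
exact: pact_stable.
Qed.

Lemma pbw_below j M : below j M -> pbw (b j) 'z_M = 'z_(j ⊙ M).
Proof. by move=> jM; rewrite pbwE pact_below. Qed.

Lemma pbw_smul x M : slt (mdeg M).+1 (pbw x 'z_M - smul crd x M).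
Proof.
elim/(basis_ind crdK): x => [|a j x IH].
  by rewrite pbw0l sub0r /smul (linear0 crd) linear0 oppr0; apply: slt_0.
rewrite pbwPl /smul (linearP crd) linearP /= opprD addrACA -scalerBr.
apply: sltP IH; rewrite crdb lextU pbwE.
by have [h _] := pact_slt j (leqnn (mdeg M)).
Qed.

Lemma pbw_sltB j M : slt (mdeg M).+1 (pbw (b j) 'z_M - 'z_(j ⊙ M)).
Proof. by have := pbw_smul (b j) M; rewrite /smul crdb lextU. Qed.

(** This reads the recursion defining [pact] backwards. As k is below j N, the leading term z_j z_k
    z_N is x_k . z_(j N), which combines with x_k . (x_j . z_N - z_(j N)). *)
Lemma pbw_swap j k N : below k N -> ~~ le j k ->
  pbw (b j) (pbw (b k) 'z_N) =
    pbw (b k) (pbw (b j) 'z_N) + pbw [lie b j, b k] 'z_N.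
Proof.
move=> kN jk; have kj : le k j by have := le_total j k; rewrite (negbTE jk).
have kjN : 'z_(j ⊙ k ⊙ N) = pbw (b k) 'z_(j ⊙ N).
  by rewrite consmCA pbw_below // below_cons // kj.
have [r_slt _] := pact_slt j (leqnn (mdeg N)); rewrite -pbwE in r_slt.
have N_slt : slt (mdeg N).+1 ('z_N : S) by apply: sltU.
rewrite (pbw_below kN).
rewrite (pbwE j (k ⊙ N)).
rewrite mdegU_cons.
rewrite (pact_cons _ kN jk).
rewrite -pbwE.
rewrite kjN.

rewrite (mact_pbw (b k) r_slt) (mact_pbw [lie b j, b k] N_slt).
by rewrite linearB /= [X in X + _]addrC subrK.
Qed.

(** The module law at one triple, so that the vectors satisfying it for given x and y form a
    subspace. *)
Let bracket_at x y u := pbw x (pbw y u) = pbw y (pbw x u) + pbw [lie x, y] u.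

Let bracket_atC x y u : bracket_at x y u -> bracket_at y x u.
Proof.
by rewrite /bracket_at => ->; rewrite [[lie y, x]]lieC pbwNl addrK.
Qed.

Let bracket_at_subspace x y : is_subspace (bracket_at x y).
Proof.
split; rewrite /bracket_at; first by rewrite !linear0 addr0.
by move=> a u v hu hv; rewrite !linearP /= hu hv scalerDr addrACA.
Qed.

Let bracket_at_basis u :
  (forall i j, bracket_at (b i) (b j) u) -> forall x y, bracket_at x y u.
Proof.
move=> bas; elim/(basis_ind crdK) => [|a i x IH] y.
  by rewrite /bracket_at lie_0x !pbw0l linear0 addr0.
have {}bas : bracket_at (b i) y u.
  elim/(basis_ind crdK): y {IH} => [|c j y IH].
    by rewrite /bracket_at lie_x0 !pbw0l linear0 addr0.
  rewrite /bracket_at (linearP (lie_bracket (b i))) /= !pbwPl linearP /=.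
  by rewrite bas IH scalerDr addrACA.
rewrite /bracket_at lie_linearl !pbwPl linearP /=.
by rewrite bas IH scalerDr addrACA.
Qed.

(** If i <= j, either i = j and the bracket vanishes, or the pair is exchanged and [pbw_swap]
    applies, i being below M by transitivity. *)
Let bracket_at_below i j M : below j M -> bracket_at (b i) (b j) 'z_M.
Proof.
move=> jM; have [ij|ij] := boolP (le i j); last exact: pbw_swap.
have [ji|ji] := boolP (le j i).
  have -> : i = j by apply: le_anti; rewrite ij ji.
  by rewrite /bracket_at lie_xx pbw0l addr0.
by apply: bracket_atC; apply: pbw_swap => //; apply: below_trans ij jM.
Qed.

(** Induction on the monomial k N, with k its least variable. If i or j is at most k,
    [bracket_at_below] applies; otherwise x_k is moved to the front and the induction hypothesis is
    used on z_N and on lower terms. *)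
Lemma pbw_lie x y u : pbw [lie x, y] u = pbw x (pbw y u) - pbw y (pbw x u).
Proof.
suff h : bracket_at x y u by rewrite h [_ + pbw _ _]addrC addrK.
move: u x y; suff mon M i j : bracket_at (b i) (b j) 'z_M.
  move=> u x y; rewrite -[u]lext_malg.
  apply: (subspace_lext (bracket_at_subspace x y)) => M _.
  exact: bracket_at_basis.
elim/(cmonom_min_ind le_total le_trans): M i j => [|k N kN IH] i j.
  by apply: bracket_at_below; apply: below1.
have [jk|jk] := boolP (le j k).
  by apply: bracket_at_below; rewrite below_cons // jk (below_trans _ jk kN).
have [ik|ik] := boolP (le i k).
  apply: bracket_atC; apply: bracket_at_below.
  by rewrite below_cons // ik (below_trans _ ik kN).
have {}IH x y u : slt (mdeg N).+1 u -> bracket_at x y u.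
  move=> u_slt; rewrite -[u]lext_malg.
  apply: (subspace_lext (bracket_at_subspace x y)) => M /(slt_msupp u_slt) MN.
  by apply: bracket_at_basis => i' j'; apply: IH.
have IHN x y : bracket_at x y 'z_N by apply: IH; apply: sltU.
(* x_j' . z_N is z_(j' N) plus terms of degree at most that of N: k is below the former, and the
   latter fall under the induction hypothesis. *)
have swap_k i' j' : ~~ le j' k -> bracket_at (b i') (b k) (pbw (b j') 'z_N).
  move=> jk'; rewrite -[pbw _ _](subrK 'z_(j' ⊙ N)).
  apply: (subspaceD (bracket_at_subspace _ _)).
    by apply: IH; apply: pbw_sltB.
  apply: bracket_at_below; rewrite below_cons // kN andbT.
  by have := le_total j' k; rewrite (negbTE jk').
(* Both x_i x_j x_k . z_N and x_j x_i x_k . z_N are expanded with x_k in front; the remaining double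
   brackets match by the Jacobi identity. *)
rewrite /bracket_at -(pbw_below kN).
rewrite (IHN (b j) (b k)) (IHN (b i) (b k)) !linearD /=.
rewrite (swap_k i j jk) (swap_k j i ik) (IHN (b i) (b j)) linearD /=.
rewrite (IHN (b i) [lie b j, b k]) (IHN (b j) [lie b i, b k]).
rewrite (IHN [lie b i, b j] (b k)) [[lie b i, [lie b j, b k]]]lie_jacobiE pbwDl.
ring.
Qed.

(** Gathers what is used of the action, hiding its recursive construction. *)
Lemma pbw_action : exists act : L -> S -> S,
  [/\ forall u, linear (act^~ u), forall x, linear (act x),
      forall x y u, act [lie x, y] u = act x (act y u) - act y (act x u),
      forall j M, below j M -> act (b j) 'z_M = 'z_(j ⊙ M)
    & forall x M, slt (mdeg M).+1 (act x 'z_M - smul crd x M)].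
Proof.
exists pbw; split; first exact: pbw_linearl.
- by move=> x; apply: linearP.
- exact: pbw_lie.
- exact: pbw_below.
- exact: pbw_smul.
Qed.

End PBWAction.

(** * The p-center *)

Section IteratedCommutators.
Context (R : nzRingType) (x : R).
Let ad (w : R) := x * w - w * x.

(** Left multiplication by x is the sum of the commuting operators ad x and right multiplication by
    x, so this is the binomial formula; the induction uses Pascal's rule. *)
Lemma exprM_ad n w : x ^+ n * w =
  \sum_(i < n.+1) (iter i ad w * x ^+ (n - i)) *+ 'C(n, i).
Proof.
elim: n w => [|n IH] w; first by rewrite big_ord1 mul1r mulr1.
rewrite exprS -mulrA IH mulr_sumr.
have step i : (i <= n)%N -> x * ((iter i ad w * x ^+ (n - i)) *+ 'C(n, i))
   = (iter i.+1 ad w * x ^+ (n - i)) *+ 'C(n, i)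
     + (iter i ad w * x ^+ (n.+1 - i)) *+ 'C(n, i).
  move=> ni; rewrite mulrnAr -mulrnDl subSn // exprS /= {2}/ad mulrBl -!mulrA.
  by rewrite subrK.
rewrite (eq_bigr _ (fun (i : 'I_n.+1) _ => step i (ltn_ord i))) big_split /=.
rewrite [X in _ + X]big_ord_recl [in RHS]big_ord_recl [RHS]/=.
rewrite addrCA !bin0; congr (_ + _).
rewrite [X in X + _]big_ord_recr [in RHS]big_ord_recr /=.
rewrite /bump /= !add1n addrAC; congr (_ + _); last by rewrite !subnn !binn.
rewrite -big_split /=; apply: eq_bigr => i _.
by rewrite !add1n subSS -mulrnDr binS addnC.
Qed.

(** The binomial coefficients strictly between the two ends vanish modulo p, which gives ad (x^p) =
    (ad x)^p. *)
Lemma commutator_exp_char p w : p \in [pchar R] ->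
  x ^+ p * w - w * x ^+ p = iter p ad w.
Proof.
move=> charR; have p_pr := pcharf_prime charR.
rewrite exprM_ad -(prednK (prime_gt0 p_pr)) big_ord_recl big_ord_recr /=.
rewrite big1 => [|i _].
  rewrite bin0 binn subn0 /bump /= add1n subnn mulr1 !mulr1n add0r.
  by rewrite addrAC subrr add0r.
apply/eqP; rewrite -mulr_natr; apply/eqP.
have /dvdnP[m ->] : (p %| 'C(p.-1.+1, bump 0 i))%N.
  rewrite prednK ?prime_gt0 // prime_dvd_bin // /bump /= add1n /=.
  by rewrite -[X in (_ < X)%N](prednK (prime_gt0 p_pr)) ltnS.
by rewrite natrM (pcharf0 charR) !mulr0.
Qed.

End IteratedCommutators.

Section Subalgebras.
Context (K : fieldType) (A : algType K).

Lemma ring_center_subalgebra : is_subalgebra (ring_center (A := A)).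
Proof.
split; first split=> [u|a u v hu hv w]; rewrite /ring_center /=.
- by rewrite mul0r mulr0.
- by rewrite mulrDl mulrDr hv -scalerAl -scalerAr hu.
- by move=> u; rewrite mul1r mulr1.
- by move=> u v hu hv w; rewrite -mulrA hv mulrA hu mulrA.
Qed.

Lemma smallest_subalgebra (S : set A) :
  is_subalgebra (smallest (@is_subalgebra K A) S).
Proof.
split; first split.
- by move=> W [[[]]].
- move=> a u v hu hv W hW; case: (hW) => [[[_ h] _ _] _].
  by apply: h; [apply: hu | apply: hv].
- by move=> W [[]].
- move=> u v hu hv W hW; case: (hW) => [[_ _ h] _].
  by apply: h; [apply: hu | apply: hv].
Qed.

Lemma subalgebraX (S : set A) u n : is_subalgebra S -> S u -> S (u ^+ n).
Proof.
case=> _ S1 SM Su; elim: n => [|n IH]; first by rewrite expr0.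
by rewrite exprS; apply: SM.
Qed.

Lemma subalgebra_prod (S : set A) (I : Type) (s : seq I) (F : I -> A) :
  is_subalgebra S -> (forall i, S (F i)) -> S (\prod_(i <- s) F i).
Proof. by case=> _ S1 SM SF; elim/big_ind: _. Qed.

End Subalgebras.

(** * Symbols in U(g) *)

Section PBWTheorem.
Context (K : fieldType) (L : lieAlgType K) (J : choiceType) (b : J -> L).
Context (crd : {linear L -> {malg K[J]}}).
Hypotheses (crdK : cancel crd (lext b)) (crdb : forall j, crd (b j) = 'z_j).
Context (le : rel J).
Hypotheses (le_total : total le) (le_trans : transitive le)
  (le_anti : antisymmetric le).
Local Notation S := {malg K[{cmonom J}]}.
Local Notation below := (below le).
Local Notation hdm := (hdm le).
Implicit Types (x y : L) (i j k : J) (M N : {cmonom J}) (u v : S).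

(** * An algebra generated by L and acting on S(L), standing for U(L) *)

Context (U : algType K) (iota : L -> U).
Hypothesis iota_linear : linear iota.
Hypothesis iota_lie : forall x y,
  iota [lie x, y] = iota x * iota y - iota y * iota x.
Hypothesis iota_ind : forall P : set U, is_subspace P -> P 1 ->
  (forall x a, P a -> P (iota x * a)) -> forall a, P a.
Context (uact : U -> S -> S).
Hypothesis uact_linearl : forall u, linear (uact^~ u).
Hypothesis uact_linearr : forall a, linear (uact a).
Hypothesis uact1 : forall u, uact 1 u = u.
Hypothesis uactM : forall a c u, uact (a * c) u = uact a (uact c u).
Local Notation act x := (uact (iota x)).
Hypothesis act_below : forall j M, below j M -> act (b j) 'z_M = 'z_(j ⊙ M).
Hypothesis act_smul : forall x M, slt (mdeg M).+1 (act x 'z_M - smul crd x M).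
Implicit Types (a c : U).

HB.instance Definition _ := GRing.isLinear.Build K L U _ iota iota_linear.
HB.instance Definition _ a :=
  GRing.isLinear.Build K S S _ (uact a) (uact_linearr a).

Fact uactPl (d : K) a c u : uact (d *: a + c) u = d *: uact a u + uact c u.
Proof. exact: uact_linearl. Qed.

Fact uact0l u : uact 0 u = 0.
Proof. by have := uactPl (-1) 0 0 u; rewrite scaler0 addr0 scaleN1r addNr. Qed.

Fact uactBl a c u : uact (a - c) u = uact a u - uact c u.
Proof. by rewrite addrC -scaleN1r uactPl scaleN1r addrC. Qed.

Fact act_lie x y u : act [lie x, y] u = act x (act y u) - act y (act x u).
Proof. by rewrite iota_lie uactBl !uactM. Qed.

Fact actPl (d : K) x y u : act (d *: x + y) u = d *: act x u + act y u.
Proof. by rewrite linearP uactPl. Qed.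

Fact act0l u : act 0 u = 0.
Proof. by rewrite linear0 uact0l. Qed.

Lemma act_slt n x u : slt n u -> slt n.+1 (act x u).
Proof.
move=> u_slt; rewrite -[u]lext_malg linear_lext.
apply: slt_lext => M /(slt_msupp u_slt) Mn /=.
rewrite -[act _ _](subrK (smul crd x M)); apply: sltD.
  exact: sltW (leqW Mn) (act_smul x M).
exact: (sltW _ (smul_slt crd x M)).
Qed.

Lemma act_sltB j M : slt (mdeg M).+1 (act (b j) 'z_M - 'z_(j ⊙ M)).
Proof. by have := act_smul (b j) M; rewrite /smul crdb lextU. Qed.

(** * The Poincare-Birkhoff-Witt isomorphism *)

Fixpoint ordered_prod n M : U :=
  if (n, hdm M) is (n'.+1, Some k) then
    iota (b k) * ordered_prod n' (divcm M (ucm k))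
  else 1.

(** The inverse of a |-> a . 1: each z_M goes to the product of its variables in nondecreasing
    order, for which fuel [mdeg M] suffices. *)
Definition omega u : U := lext (fun M => ordered_prod (mdeg M) M) u.

HB.instance Definition _ := GRing.isLinear.Build K S U _ omega (lext_is_linear _).

Fact omega0 : omega 0 = 0.
Proof. exact: linear0. Qed.

Fact omegaP (d : K) u v : omega (d *: u + v) = d *: omega u + omega v.
Proof. exact: linearP. Qed.

Fact iota0 : iota 0 = 0.
Proof. exact: linear0. Qed.

Lemma omega1 : omega 'z_mone = 1.
Proof. by rewrite /omega lextU mdeg1. Qed.

Lemma omega_cons k N : below k N ->
  omega 'z_(k ⊙ N) = iota (b k) * omega 'z_N.
Proof.
move=> kN; rewrite /omega !lextU mdegU_cons /=.
by rewrite (hdm_cons le_total le_anti kN) consmK.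
Qed.

Let omega_act_subspace x :
  is_subspace [set u | omega (act x u) = iota x * omega u]%classic.
Proof.
split=> [|c u v] /=; first by rewrite linear0 omega0 mulr0.
by move=> hu hv; rewrite linearP !omegaP hu hv mulrDr scalerAr.
Qed.

(** Same induction as for the module law: when j exceeds the least variable k, x_j x_k is replaced
    by x_k x_j + [x_j, x_k] on both sides. Hence omega (a . 1) = a, so that a |-> a . 1 is
    injective. *)
Lemma omega_act x u : omega (act x u) = iota x * omega u.
Proof.
move: u x; suff mon M j : omega (act (b j) 'z_M) = iota (b j) * omega 'z_M.
  move=> u x; rewrite -[u]lext_malg.
  apply: (subspace_lext (omega_act_subspace x)) => M _ /=.
  elim/(basis_ind crdK): x => [|c j x IH].
    by rewrite act0l omega0 iota0 mul0r.
  by rewrite actPl iota_linear omegaP mon IH mulrDl scalerAl.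
elim/(cmonom_min_ind le_total le_trans): M j => [|k N kN IH] j.
  by rewrite act_below ?omega_cons ?below1.
have [jk|jk] := boolP (le j k).
  have jM : below j (k ⊙ N) by rewrite below_cons // jk (below_trans _ jk kN).
  by rewrite act_below // omega_cons.
have IHlt x u : slt (mdeg N).+1 u -> omega (act x u) = iota x * omega u.
  move=> u_slt; rewrite -[u]lext_malg.
  apply: (subspace_lext (omega_act_subspace x)) => M /(slt_msupp u_slt) MN /=.
  elim/(basis_ind crdK): x => [|c i x IHx].
    by rewrite act0l omega0 iota0 mul0r.
  by rewrite actPl iota_linear omegaP (IH M MN) IHx mulrDl scalerAl.
have N_slt : slt (mdeg N).+1 ('z_N : S) by apply: sltU.
have r_slt := act_sltB j N.
(* x_j . z_N is z_(j N), which k is below, plus terms covered by the induction hypothesis. *)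
have kE : omega (act (b k) (act (b j) 'z_N))
    = iota (b k) * omega (act (b j) 'z_N).
  rewrite -[act (b j) 'z_N](subrK 'z_(j ⊙ N)).
  apply: (subspaceD (omega_act_subspace (b k))); first exact: IHlt r_slt.
  have kjN : below k (j ⊙ N).
    by rewrite below_cons // kN andbT; have := le_total j k; rewrite (negbTE jk).
  by rewrite /= act_below // omega_cons.
have jkE : act (b j) (act (b k) 'z_N)
    = act (b k) (act (b j) 'z_N) + act [lie b j, b k] 'z_N.
  by rewrite act_lie addrC subrK.
rewrite (omega_cons kN) -(act_below kN).
have jE := IHlt (b j) _ N_slt; have jk'E := IHlt [lie b j, b k] _ N_slt.
rewrite jkE linearD /= kE.
rewrite jE.
rewrite jk'E.
rewrite iota_lie.
exact: commutator_mul.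
Qed.

Lemma omega_uact a u : omega (uact a u) = a * omega u.
Proof.
pose P := [set a | omega (uact a u) = a * omega u]%classic.
apply: (iota_ind (P := P)) => [||x {}a]; rewrite /P /=.
- split=> [|c a1 a2] /=; first by rewrite uact0l omega0 mul0r.
  by rewrite uactPl omegaP => -> ->; rewrite mulrDl scalerAl.
- by rewrite uact1 mul1r.
- by rewrite uactM omega_act => ->; rewrite mulrA.
Qed.

Definition sigma a : S := uact a 'z_mone.

Lemma sigma_linear : linear sigma.
Proof. exact: uact_linearl. Qed.

HB.instance Definition _ := GRing.isLinear.Build K U S _ sigma sigma_linear.

Lemma sigmaK : cancel sigma omega.
Proof. by move=> a; rewrite omega_uact omega1 mulr1. Qed.

Lemma sigmaM a c : sigma (a * c) = uact a (sigma c).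
Proof. exact: uactM. Qed.

(** The rule x_k . z_N = z_(k N) for k below N rebuilds z_M one variable at a time. With [sigmaK]
    this is the Poincare-Birkhoff-Witt theorem: the ordered products form a basis of U. *)
Lemma omegaK : cancel omega sigma.
Proof.
have sub : is_subspace [set u | sigma (omega u) = u]%classic.
  split=> [|c u v] /=; first by rewrite omega0 linear0.
  by rewrite omegaP linearP /= => -> ->.
move=> u; rewrite -[u]lext_malg; apply: (subspace_lext sub) => M _ /=.
elim/(cmonom_min_ind le_total le_trans): M => [|k N kN IH].
  by rewrite omega1 /sigma uact1.
by rewrite (omega_cons kN) sigmaM IH ?leqnn // act_below.
Qed.

(** It suffices to treat ordered products, each factor of which raises the degree by at most one. *)
Lemma uact_slt n a u m : slt n.+1 (sigma a) -> slt m u -> slt (n + m) (uact a u).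
Proof.
move=> a_slt u_slt; rewrite -[a]sigmaK -[sigma a]lext_malg.
have sub : is_subspace [set t | slt (n + m) (uact (omega t) u)]%classic.
  split=> [|d t t'] /=; last by rewrite omegaP uactPl; apply: sltP.
  by rewrite omega0 uact0l; apply: slt_0.
apply: (subspace_lext sub) => M /(slt_msupp a_slt); rewrite ltnS /= => Mn.
apply: (sltW (n := mdeg M + m)); first by rewrite leq_add2r.
elim/(cmonom_min_ind le_total le_trans): M {Mn} => [|k N kN IH].
  by rewrite omega1 uact1 mdeg1.
rewrite (omega_cons kN) uactM mdegU_cons addSn.
exact: (act_slt _ (IH N (leqnn _))).
Qed.

(** The strictness moves from [u] to [a]; when n = 0, a is zero. *)
Lemma uact_slt_strict n a u m :
  slt n (sigma a) -> slt m.+1 u -> slt (n + m) (uact a u).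
Proof.
case: n => [|n] a_slt u_slt; last by rewrite addSnnS; apply: uact_slt.
rewrite -[a]sigmaK (slt0_eq0 a_slt) omega0.
by rewrite uact0l; apply: slt_0.
Qed.

Lemma uact_omega_slt M N :
  slt (mdeg M + mdeg N) (uact (omega 'z_M) 'z_N - 'z_(mmul M N)).
Proof.
elim/(cmonom_min_ind le_total le_trans): M => [|k M kM IH].
  by rewrite omega1 uact1 mul1m subrr; apply: slt_0.
rewrite (omega_cons kM) uactM mdegU_cons addSn.
have -> : mmul (k ⊙ M) N = k ⊙ mmul M N by rewrite consm.unlock mulmA.
rewrite -[uact _ 'z_N](subrK 'z_(mmul M N)) linearD /= -addrA.
apply: sltD; first exact: act_slt (IH M (leqnn _)).
by rewrite -mdegM; apply: act_sltB.
Qed.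

(* [lead a M]: the symbol of [a] in gr U(L) = S(L) is the monomial z_M. *)
Definition lead a M := slt (mdeg M) (sigma a - 'z_M).

Lemma lead_slt a M : lead a M -> slt (mdeg M).+1 (sigma a).
Proof.
move=> aM; rewrite -[sigma a](subrK 'z_M); apply: sltD; last exact: sltU.
exact: sltW aM.
Qed.

Lemma lead1 : lead 1 mone.
Proof. by rewrite /lead /sigma uact1 subrr; apply: slt_0. Qed.

(** The difference splits into a acting on the lower terms of c, the lower terms of a acting on z_N,
    and the correction for an ordered product acting on z_N. *)
Lemma leadM a c M N : lead a M -> lead c N -> lead (a * c) (mmul M N).
Proof.
move=> aM cN; rewrite /lead sigmaM mdegM.
have -> : uact a (sigma c) - 'z_(mmul M N) = uact a (sigma c - 'z_N)
    + (uact (a - omega 'z_M) 'z_N + (uact (omega 'z_M) 'z_N - 'z_(mmul M N))).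
  by rewrite uactBl linearB /=; ring.
apply: sltD; first exact: uact_slt (lead_slt aM) cN.
apply: sltD; last exact: uact_omega_slt.
by apply: uact_slt_strict; [rewrite linearB /= omegaK | apply: sltU].
Qed.

Lemma lead_sub a c M : lead a M -> slt (mdeg M) (sigma c) -> lead (a - c) M.
Proof. by move=> aM c_slt; rewrite /lead linearB /= addrAC; apply: sltB. Qed.

Lemma sigma_in_slt x : slt 2 (sigma (iota x)).
Proof. by rewrite /sigma; apply: act_slt; apply: sltU; rewrite mdeg1. Qed.

Lemma lead_coef a M N : lead a M -> (mdeg M <= mdeg N)%N ->
  (sigma a)@_N = (M == N)%:R.
Proof.
move=> aM MN; have := slt_coef aM MN.
by rewrite mcoeffB mcoeff_z => /eqP; rewrite subr_eq0 => /eqP.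
Qed.

(** Exponents given as a plain function, up to pointwise equality, let the symbols of products and
    powers be computed by arithmetic on exponents. *)
Definition leadf a (f : J -> nat) := exists2 M : {cmonom J}, M =1 f & lead a M.

Lemma leadf1 : leadf 1 (fun=> 0%N).
Proof. by exists mone => [t|]; [rewrite cm1 | exact: lead1]. Qed.

Lemma leadfM a c f g : leadf a f -> leadf c g ->
  leadf (a * c) (fun t => f t + g t)%N.
Proof.
move=> [M Mf aM] [N Ng cN]; exists (mmul M N); last exact: leadM.
by move=> t; rewrite cmM Mf Ng.
Qed.

Lemma eq_leadf a f g : f =1 g -> leadf a f -> leadf a g.
Proof. by move=> fg [M Mf aM]; exists M => // t; rewrite Mf. Qed.

Lemma leadfX n a f : leadf a f -> leadf (a ^+ n) (fun t => n * f t)%N.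
Proof.
move=> af; elim: n => [|n IH]; first by rewrite expr0; apply: leadf1.
by rewrite exprS; apply: leadfM.
Qed.

Lemma leadf_prod (T : Type) (s : seq T) (F : T -> U) (f : T -> J -> nat) :
  (forall r, leadf (F r) (f r)) ->
  leadf (\prod_(r <- s) F r) (fun t => \sum_(r <- s) f r t)%N.
Proof.
move=> Ff; elim: s => [|r s IH].
  by rewrite big_nil; apply: eq_leadf leadf1 => t; rewrite big_nil.
rewrite big_cons; apply: eq_leadf (leadfM (Ff r) IH) => t.
by rewrite big_cons.
Qed.

Lemma lead_in j : lead (iota (b j)) (j ⊙ mone).
Proof.
rewrite /lead /sigma act_below ?below1 // subrr; exact: slt_0.
Qed.

(** As n > 1, the degree n of the power exceeds that of [iota x], so subtracting [iota x] keeps the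
    symbol. *)
Lemma leadf_pow_sub j x n : (1 < n)%N ->
  leadf (iota (b j) ^+ n - iota x) (fun t => n * (j == t))%N.
Proof.
move=> n1.
have [M Mf lM] : leadf (iota (b j) ^+ n) (fun t => n * (j == t))%N.
  apply: leadfX; exists (j ⊙ mone); last exact: lead_in.
  by move=> t; rewrite consmE cm1 addn0.
exists M => //; apply: lead_sub => //; apply: sltW (sigma_in_slt x).
rewrite (leq_trans n1) // mdegE (big_fsetD1 j) /=; last first.
  by rewrite -cmE_neq0 Mf eqxx muln1 -lt0n ltnW.
by rewrite Mf eqxx muln1 leq_addr.
Qed.

(** * Derivations of S(L) as symbols of commutators *)

Definition dmon y M : S :=
  \sum_(k <- finsupp M) (M k)%:R *: smul crd [lie y, b k] (divcm M (ucm k)).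

(* The derivation of S(L) extending [ad y]. *)
Definition deriv y u : S := lext (dmon y) u.

Definition shift k u : S := lext (fun M => 'z_(k ⊙ M)) u.

HB.instance Definition _ y :=
  GRing.isLinear.Build K S S _ (deriv y) (lext_is_linear _).
HB.instance Definition _ k :=
  GRing.isLinear.Build K S S _ (shift k) (lext_is_linear _).

Fact shiftP k (a : K) u v : shift k (a *: u + v) = a *: shift k u + shift k v.
Proof. exact: linearP. Qed.

Fact shift0 k : shift k 0 = 0.
Proof. exact: linear0. Qed.

Fact derivP y (a : K) u v : deriv y (a *: u + v) = a *: deriv y u + deriv y v.
Proof. exact: linearP. Qed.

Fact deriv0 y : deriv y 0 = 0.
Proof. exact: linear0. Qed.

Lemma shift_smul k x N : shift k (smul crd x N) = smul crd x (k ⊙ N).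
Proof.
rewrite /smul linear_lext; apply: eq_lext => j _ /=.
by rewrite /shift lextU consmCA.
Qed.

Lemma act_shift n k u : slt n u -> slt n (act (b k) u - shift k u).
Proof.
move=> u_slt; rewrite -[u]lext_malg.
have sub : is_subspace [set v | slt n (act (b k) v - shift k v)]%classic.
  split=> [|c v w] /=; first last.
    by rewrite uact_linearr shiftP opprD addrACA -scalerBr; apply: sltP.
  rewrite (linear0 (act (b k))) shift0 subr0; exact: slt_0.
apply: (subspace_lext sub) => M /(slt_msupp u_slt) Mn /=.
by rewrite /shift lextU; apply: sltW (act_sltB k M).
Qed.

Lemma dmon_slt y M : slt (mdeg M).+1 (dmon y M).
Proof.
rewrite /dmon; apply: (subspace_sum (slt_subspace K J (mdeg M).+1)) => k kM _.
apply: (subspaceZ (slt_subspace K J (mdeg M).+1)).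
by rewrite -{1}(divcmK kM) mdegU_cons; apply: smul_slt.
Qed.

(** Leibniz rule: the exponent of j in z_k z_N is [(k == j) + N j], which separates the new factor
    from those of z_N. *)
Lemma dmon_cons y k N :
  dmon y (k ⊙ N) = smul crd [lie y, b k] N + shift k (dmon y N).
Proof.
rewrite /dmon; under eq_bigr do rewrite consmE natrD scalerDl.
rewrite big_split /=; congr (_ + _).
  rewrite (big_fsetD1 k) /=; last by rewrite cons_finsupp eqxx.
  rewrite eqxx scale1r consmK big1_fset ?addr0 // => j.
  by rewrite in_fsetD1 eq_sym => /andP[/negbTE-> _]; rewrite scale0r.
rewrite linear_sum /= -(big_fset_incl _ (A := finsupp N)) /=; last 2 first.
- by apply/fsubsetP => j jN; rewrite cons_finsupp jN orbT.
- by move=> j _; rewrite -cmE_eq0 => /eqP ->; rewrite scale0r.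
rewrite !big_seq; apply: eq_bigr => j jN; rewrite linearZ /= shift_smul.
by congr (_ *: smul _ _ _); rewrite -{1}(divcmK jN) consmCA consmK.
Qed.

(** With the least variable split off, [y, x_k w] = [y, x_k] w + x_k [y, w] matches [dmon_cons] up
    to lower terms. *)
Lemma sigma_lie_mon y M :
  slt (mdeg M) (sigma (iota y * omega 'z_M - omega 'z_M * iota y)
                - deriv y 'z_M).
Proof.
elim/(cmonom_min_ind le_total le_trans): M => [|k N kN IH].
  rewrite omega1 mulr1 mul1r subrr /deriv lextU /dmon mdom1 big_seq_fset0 subr0.
  by rewrite linear0; apply: slt_0.
move: {IH}(IH N (leqnn _)).
rewrite (omega_cons kN) mdegU_cons /deriv !lextU dmon_cons.
set w := omega _; set d := dmon y N => IH.
have -> : iota y * (iota (b k) * w) - iota (b k) * w * iota y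
    = iota [lie y, b k] * w
      + iota (b k) * (iota y * w - w * iota y).
  by rewrite iota_lie mulrBl mulrBr !mulrA addrA subrK.
rewrite linearD /= !sigmaM !omegaK opprD addrACA.
apply: sltD; first exact: act_smul.
rewrite -[sigma _](subrK d) linearD /= -addrA.
by apply: sltD; [apply: act_slt | apply: act_shift; apply: dmon_slt].
Qed.

(** For a central [c] of degree n, it follows that D_y annihilates the top-degree part of
    [sigma c]. *)
Lemma sigma_lie y n c : slt n.+1 (sigma c) ->
  slt n (sigma (iota y * c - c * iota y) - deriv y (sigma c)).
Proof.
move=> c_slt; rewrite -{1 2}[c]sigmaK -[sigma c]lext_malg.
pose f u := sigma (iota y * omega u - omega u * iota y) - deriv y u.
have f_lin : linear f.
  move=> a u v; rewrite /f omegaP derivP.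
  rewrite (commutatorP (iota y)) sigma_linear opprD addrACA.
  by rewrite (scalerBr a (sigma _) (deriv y u)).
have sub : is_subspace [set u | slt n (f u)]%classic.
  split=> [|a u v] /=; last by rewrite f_lin; apply: sltP.
  by rewrite /f omega0 deriv0 mulr0 mul0r subrr linear0 subr0; apply: slt_0.
apply: (subspace_lext sub) => M /(slt_msupp c_slt); rewrite ltnS => Mn.
exact: sltW Mn (sigma_lie_mon y M).
Qed.

(** Since z_t does not divide z_N, it can only come from the factor x. *)
Lemma smul_coef x N t m : N t = 0%N ->
  (smul crd x N)@_(t ⊙ m) = (crd x)@_t * (N == m)%:R.
Proof.
move=> Nt; rewrite /smul mcoeff_lext.
have -> : (crd x)@_t = \sum_(j <- msupp (crd x)) (crd x)@_j * (j == t)%:R.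
  rewrite -{1}[crd x]lext_malg mcoeff_lext.
  by apply: eq_bigr => j _; rewrite mcoeff_z.
rewrite mulr_suml; apply: eq_bigr => j _; rewrite mcoeff_z -mulrA; congr (_ * _).
rewrite -natrM mulnb; congr (_ %:R); congr nat_of_bool.
apply/eqP/andP => [jN|[/eqP-> /eqP->] //].
have /eqP jt : j == t.
  apply: contraT => /negbTE njt; have := congr1 (fun M : {cmonom J} => M t) jN.
  by rewrite /= !consmE Nt njt eqxx.
by move: jN; rewrite jt eqxx => /consmI ->.
Qed.

(** As z_t divides neither a monomial of f nor m, it comes from [y, b_k] replacing a factor z_k; the
    monomial was then z_k m, whose exponent at k is [(m k).+1]. Linearity of the bracket gathers the
    sum over k into one vector. *)
Lemma deriv_coef y (f : S) t (m : {cmonom J}) (F : {fset J}) :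
    (forall M k, M \in msupp f -> k \in finsupp M -> k \in F) ->
    t \notin F -> m t = 0%N ->
  (deriv y f)@_(t ⊙ m) =
    (crd [lie y, \sum_(k <- F) (f@_(k ⊙ m) * (m k).+1%:R) *: b k])@_t.
Proof.
move=> fF tF mt; rewrite /deriv mcoeff_lext.
have dmonE M : M \in msupp f -> (dmon y M)@_(t ⊙ m) =
    \sum_(k <- F) (M == k ⊙ m)%:R * (m k).+1%:R * (crd [lie y, b k])@_t.
  move=> Mf; rewrite /dmon (big_morph (mcoeff _) (mcoeffD _) (mcoeff0 _)).
  have Mt : M t = 0%N.
    by apply/eqP; rewrite cmE_eq0; apply: contra tF; apply: fF.
  rewrite (big_fset_incl _ (B := F)) /=; last 2 first.
  - by apply/fsubsetP => k; apply: fF.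
  - by move=> k _; rewrite -cmE_eq0 => /eqP ->; rewrite scale0r mcoeff0.
  apply: eq_bigr => k _; rewrite mcoeffZ smul_coef; last by rewrite divcmE Mt.
  rewrite mulrCA [RHS]mulrC -!natrM; congr (_ * _%:R).
  have [Mk|Mk] := boolP (k \in finsupp M); last first.
    have /eqP Mk0 : M k == 0%N by rewrite cmE_eq0.
    rewrite Mk0 mul0n; case: eqP => // MkE.
    by move: Mk0; rewrite MkE consmE eqxx.
  have -> : (M == k ⊙ m) = (divcm M (ucm k) == m).
    apply/eqP/eqP => [->|<-]; first by rewrite consmK.
    by rewrite divcmK.
  case: eqP => [<-|]; rewrite ?muln0 ?mul0n // muln1 mul1n divcmE cmU eqxx subn1.
  by rewrite prednK // lt0n cmE_neq0.
rewrite big_seq (eq_bigr _ (fun M Mf => congr1 (fun r => f@_M * r) (dmonE M Mf))).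
rewrite -big_seq; under eq_bigr do rewrite mulr_sumr.
rewrite exchange_big /= linear_sum linear_sum.
rewrite (big_morph (mcoeff _) (mcoeffD _) (mcoeff0 _)); apply: eq_bigr => k _.
rewrite linearZ linearZ mcoeffZ /=.
under eq_bigr do rewrite !mulrA -mulrA; rewrite -mulr_suml -mulrA; congr (_ * _).
rewrite -[in RHS](lext_malg f) mcoeff_lext.
by apply: eq_bigr => M _; rewrite mcoeff_z.
Qed.

(** * The center of U(L) *)

Section Center.
Context (p : nat) (charK : p \in [pchar K]) (q : J -> L).
Hypothesis adq : forall j y, [lie q j, y] = iter p (lie_bracket (b j)) y.
(** This says that [L, x] is infinite-dimensional: no finite set of coordinates supports it. *)
Hypothesis ad_infinite : forall (F : {fset J}) x, x != 0 ->
  exists y t, t \notin F /\ (crd [lie y, x])@_t != 0.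

Let gen j : U := iota (b j) ^+ p - iota (q j).
Local Notation Z := (ring_center (A := U)).
Local Notation G := (smallest (@is_subalgebra K U) (range gen)).

(** ad (x_j^p) = (ad x_j)^p = ad q_j, hence [gen j] commutes with L, which generates U. *)
Lemma gen_central j : Z (gen j).
Proof.
have charU : p \in [pchar U].
  by rewrite inE (pcharf_prime charK) /= -scaler_nat (pcharf0 charK) scale0r.
have iota_ad n x : iter n (fun w => iota (b j) * w - w * iota (b j)) (iota x)
    = iota (iter n (lie_bracket (b j)) x).
  by elim: n => //= n ->; rewrite iota_lie.
have gen_iota x : gen j * iota x = iota x * gen j.
  have := commutator_exp_char (iota (b j)) (iota x) charU.
  rewrite iota_ad -adq iota_lie /gen mulrBl mulrBr => /eqP.
  move: (iota (q j) * _) (_ * iota (q j)) => s t; rewrite subr_eq => /eqP ->.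
  by rewrite addrAC [s - t - s]addrAC subrr add0r addrC.
rewrite /ring_center /=.
apply: (iota_ind (P := [set a | gen j * a = a * gen j]%classic)) => /=.
- split=> [|d a c] /=; first by rewrite mulr0 mul0r.
  move=> ha hc; rewrite mulrDr [(d *: a + c) * _]mulrDl hc.
  by rewrite -scalerAr -scalerAl ha.
- by rewrite mulr1 mul1r.
- by move=> x a ha; rewrite mulrA gen_iota -mulrA ha mulrA.
Qed.

Lemma gen_subalgebra : is_subalgebra G.
Proof. exact: smallest_subalgebra. Qed.

Lemma gen_in j : G (gen j).
Proof. by move=> W [_]; apply; exists j. Qed.

Lemma sub_gen_center a : G a -> Z a.
Proof.
apply; split; first exact: ring_center_subalgebra.
by move=> _ [j _ <-]; apply: gen_central.
Qed.

Lemma leadf_gen j : leadf (gen j) (fun t => p * (j == t))%N.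
Proof. by apply: leadf_pow_sub; apply: prime_gt1 (pcharf_prime charK). Qed.

(** Let z_M = z_k m. The vector [x] of the coefficients of m in the partial derivatives of [sigma c]
    is shown to be zero; its k-th coordinate is the coefficient of z_M times [M k], so p divides
    [M k]. *)
Lemma center_top_coef c n M k : Z c -> slt n.+1 (sigma c) -> mdeg M = n ->
  (sigma c)@_M != 0 -> (p %| M k)%N.
Proof.
move=> Zc c_slt Mn cM; set f := sigma c in c_slt cM.
have [kM|] := boolP (k \in finsupp M); last by rewrite -cmE_eq0 => /eqP ->.
have Mf : M \in msupp f by rewrite -mcoeff_neq0.
pose m := divcm M (ucm k); pose F := (\bigcup_(N <- msupp f) finsupp N)%fset.
have fF N i : N \in msupp f -> i \in finsupp N -> i \in F.
  by move=> Nf iN; apply/bigfcupP; exists N; rewrite ?Nf.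
have mM : k ⊙ m = M by rewrite divcmK.
have mF i : i \notin F -> m i = 0%N.
  move=> iF; have /eqP Mi : M i == 0%N.
    by rewrite cmE_eq0; apply: contra iF; apply: fF.
  by rewrite divcmE Mi.
pose x := \sum_(i <- F) (f@_(i ⊙ m) * (m i).+1%:R) *: b i.
(* A nonzero x would give y and t outside F with a nonzero coefficient of z_t m in D_y f, whereas
   D_y f has degree less than n, the degree of z_t m. *)
have x0 : x = 0.
  apply/eqP; apply: contraT => /(ad_infinite F) [y [t [tF]]].
  rewrite -(deriv_coef y fF tF (mF t tF)) => /eqP[].
  have D_slt := sigma_lie y c_slt; rewrite Zc subrr linear0 sub0r in D_slt.
  have := slt_coef (sltN D_slt) (m := t ⊙ m); rewrite opprK => -> //.
  by rewrite mdegU_cons -Mn -mM mdegU_cons.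
have : (crd x)@_k = 0 by rewrite x0 linear0 mcoeff0.
rewrite linear_sum (big_morph (mcoeff _) (mcoeffD _) (mcoeff0 _)).
rewrite (big_fsetD1 k) /=; last exact: fF Mf kM.
rewrite linearZ /= crdb mcoeffZ mcoeff_z eqxx mulr1 mM big1_fset ?addr0; last first.
  move=> i; rewrite in_fsetD1 => /andP[/negbTE ik _] _.
  by rewrite linearZ /= crdb mcoeffZ mcoeff_z ik mulr0.
move/eqP; rewrite mulf_eq0 (negbTE cM) /= -(dvdn_pcharf charK).
by rewrite -[in X in _ -> X]mM consmE eqxx.
Qed.

Let gen_mon M : U := \prod_(j <- finsupp M) gen j ^+ (M j %/ p).

(** The symbol of [gen j] is z_j^p, and symbols multiply. *)
Lemma lead_gen_mon M : (forall k, (p %| M k)%N) -> lead (gen_mon M) M.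
Proof.
move=> pM; have [|N NE] := @leadf_prod _ (finsupp M)
  (fun j => gen j ^+ (M j %/ p)) (fun j t => M j %/ p * (p * (j == t)))%N.
  by move=> j; apply: leadfX; apply: leadf_gen.
have -> // : N = M.
apply/eqP/cmP => t; rewrite NE; under eq_bigr do rewrite mulnA divnK //.
have [tM|tM] := boolP (t \in finsupp M).
  rewrite (big_fsetD1 t) //= eqxx muln1 big1_fset ?addn0 // => j.
  by rewrite in_fsetD1 => /andP[/negbTE -> _] _; rewrite muln0.
have /eqP -> : M t == 0%N by rewrite cmE_eq0.
by rewrite big1_fset // => j jM _; case: eqP tM => [<-|]; rewrite ?jM ?muln0.
Qed.

(** Induction on the degree: the top coefficients of [sigma c] sit on monomials in the z_j^p, so c
    and the combination r of the [gen_mon M] have the same top part. As r is central, c - r is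
    central of smaller degree. *)
Lemma center_sub_gen c : Z c -> G c.
Proof.
have [n] : exists n, slt n (sigma c).
  exists (msize (sigma c)); split=> m /msize_mdeg_ge; exact: mcoeff_outdom.
elim: n c => [|n IH] c c_slt Zc.
  have -> : c = 0 by rewrite -[c]sigmaK (slt0_eq0 c_slt) omega0.
  by case: gen_subalgebra => [[]].
have [G_sub _ _] := gen_subalgebra.
pose f := sigma c.
pose r := \sum_(M <- msupp f | mdeg M == n) f@_M *: gen_mon M.
have Gr : G r.
  apply: (subspace_sum G_sub) => M _ _; apply: (subspaceZ G_sub).
  apply: (subalgebra_prod _ gen_subalgebra) => j.
  by apply: (subalgebraX _ gen_subalgebra); apply: gen_in.
rewrite -[c](subrK r); apply: (subspaceD G_sub) => //; apply: IH; last first.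
  have [Z_sub _ _] := ring_center_subalgebra U.
  by apply: (subspaceB Z_sub) => //; apply: sub_gen_center.
rewrite linearB /= -/f -[X in X - _]lext_malg lextE.
rewrite (bigID (fun M => mdeg M == n)) /=.
rewrite linear_sum addrAC -sumrB; apply: sltD.
  apply: (subspace_sum (slt_subspace K J n)) => M Mf /eqP Mn.
  rewrite linearZ /= -scalerBr; apply: (subspaceZ (slt_subspace K J n)).
  rewrite -opprB; apply: sltN; rewrite -Mn; apply: lead_gen_mon => k.
  by apply: (center_top_coef k Zc c_slt Mn); rewrite mcoeff_neq0.
apply: (subspace_sum (slt_subspace K J n)) => M Mf Mn.
apply: (subspaceZ (slt_subspace K J n)); apply: sltU.
by rewrite ltn_neqAle Mn -ltnS (slt_msupp c_slt).
Qed.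

(** Distinct monomials in the generators have distinct symbols [lm m]. At a symbol of largest degree
    among those of the monomials of P, the coefficient of the value of P is a nonzero coefficient of
    P. *)
Lemma gen_independent : alg_independent gen.
Proof.
move=> n j P j_inj P0.
pose mon (m : 'X_{1..n}) := \prod_(l < n) gen (j l) ^+ m l.
have lm_ex (m : 'X_{1..n}) : exists M : {cmonom J},
    (forall t, M t = \sum_(l < n) m l * (p * (j l == t)))%N /\ lead (mon m) M.
  have [|M ME Ml] := @leadf_prod _ (index_enum 'I_n)
    (fun l => gen (j l) ^+ m l) (fun l t => m l * (p * (j l == t)))%N.
    by move=> l; apply: leadfX; apply: leadf_gen.
  by exists M.
have [lm lmP] := choice lm_ex.
have lm_inj : injective lm.
  move=> m1 m2 eq_lm; apply/eqP/cmP => k.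
  (* As the indices are distinct, only the factor k contributes to this exponent; dividing by p
     recovers m. *)
  have lmE m : lm m (j k) = (m k * p)%N.
    rewrite (lmP m).1 (bigD1 k) //= eqxx muln1 big1 ?addn0 // => i ik.
    by rewrite (inj_eq j_inj) (negbTE ik) !muln0.
  have := lmE m2; rewrite -eq_lm lmE => /eqP.
  by rewrite eqn_pmul2r ?prime_gt0 ?(pcharf_prime charK) // => /eqP.
apply/malgP => m; rewrite mcoeff0; apply/eqP; apply: contraT.
rewrite mcoeff_neq0 => mP.
pose deg_in d := has (fun m => mdeg (lm m) == d) (msupp P).
have deg_ex : exists d, deg_in d by exists (mdeg (lm m)); apply/hasP; exists m.
have deg_ub d : deg_in d -> (d <= \max_(m <- msupp P) mdeg (lm m))%N.
  by case/hasP => m' m'P /eqP <-; apply: leq_bigmax_seq.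
have [d /hasP[m0 m0P /eqP m0d] max_d] := ex_maxnP deg_ex deg_ub.
have : (sigma (mpoly_eval (gen \o j) P))@_(lm m0) = 0.
  by rewrite P0 linear0 mcoeff0.
rewrite /mpoly_eval mmapE linear_sum (big_morph (mcoeff _) (mcoeffD _) (mcoeff0 _)).
rewrite (big_fsetD1 m0) //= big1_fset ?addr0 => [|m' m'P _].
  rewrite mulr_algl linearZ /= mcoeffZ (lead_coef (lmP m0).2) // eqxx mulr1.
  by move/eqP; rewrite mcoeff_eq0 m0P.
move: m'P; rewrite in_fsetD1 => /andP[m'0 m'P].
rewrite mulr_algl linearZ /= mcoeffZ (lead_coef (lmP m').2).
  by rewrite (inj_eq lm_inj) (negbTE m'0) mulr0.
by rewrite m0d; apply: max_d; apply/hasP; exists m'.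
Qed.

Lemma center_freely_generated : freely_generated Z gen.
Proof.
split; last exact: gen_independent; first by move=> u v Zu _; apply: Zu.
by apply/seteqP; split; [exact: center_sub_gen | exact: sub_gen_center].
Qed.

End Center.

End PBWTheorem.

(** * The center of U(L) for L with an arbitrarily indexed basis *)

Lemma total_order_exists (T : eqType) :
  exists le : rel T, [/\ total le, transitive le & antisymmetric le].
Proof.
have [le wo] := well_ordering_principle T.
have chain_le : wo_chain le predT by move=> A _; apply: wo.
have le_anti : antisymmetric le.
  by move=> x y; apply: (wo_chain_antisymmetric chain_le).
have le_total : total le by move=> x y; apply: (wo_chainW chain_le).
exists le; split=> // y x z xy yz.
(* Transitivity follows by looking at which of x, y, z is the least of the three. *)
have [|m [[ms min_m] _]] := wo [mem [:: x; y; z]].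
  by exists x; apply: mem_head.
have [mx [my mz]] : le m x /\ le m y /\ le m z.
  by do !split; apply: min_m; rewrite !inE eqxx ?orbT.
move: ms; rewrite !inE => /or3P[] /eqP em.
- by rewrite -em.
- by rewrite (le_anti x y) // xy -em.
- by rewrite -(le_anti y z) // yz -em.
Qed.

Section EnvelopingCenter.
Context (K : fieldType) (p : nat) (charK : p \in [pchar K]).
Context (L : lieAlgType K) (J : choiceType) (b : J -> L) (q : J -> L).

(** The last hypothesis states the infinite dimension of [L, x] through linear forms, which frees it
    from a choice of coordinate map. *)
Theorem envel_center_free : is_basis b ->
    (forall j y, [lie q j, y] = iter p (lie_bracket (b j)) y) ->
    (forall (F : {fset J}) x, x != 0 -> exists y (phi : {linear L -> K^o}),
       (forall j, j \in F -> phi (b j) = 0) /\ phi [lie y, x] != 0) ->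
  freely_generated (ring_center (A := envel L))
    (fun j => envel_in (b j) ^+ p - envel_in (q j)).
Proof.
move=> /basis_coordinates [crd0 [crd_lin crdK crdb]] adq ad_inf.
pose crdM := GRing.isLinear.Build K L {malg K[J]} _ crd0 crd_lin.
pose crd : {linear L -> {malg K[J]}} := HB.pack crd0 crdM.
have [le [le_total le_trans le_anti]] := total_order_exists J.
have [act [actl actr act_lie act_below act_smul]] :=
  @pbw_action K L J b crd crdK crdb le le_total le_trans le_anti.
have [uact [uactl uactr uact1 uactM uact_in]] := envel_module actl actr act_lie.
apply: (@center_freely_generated K L J b crd crdK crdb le le_total le_trans
  le_anti (envel L) (@envel_in K L) (@envel_in_linear K L) (@envel_in_lie K L)
  (@envel_ind K L) uact uactl uactr uact1 uactM) => //.
- by move=> j M jM; rewrite uact_in act_below.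
- by move=> x M; rewrite uact_in; apply: act_smul.
move=> F x /(ad_inf F) [y [phi [phiF phix]]]; exists y.
(* If every coordinate of [y, x] outside F vanished, so would phi [y, x], as phi kills the [b j]
   with j in F. *)
apply: contrapT => noT; move/eqP: phix; apply.
rewrite -[[lie y, x]]crdK linear_lext lextE big_seq big1 // => t _ /=.
have [tF|tF] := boolP (t \in F); first by rewrite phiF // scaler0.
have [->|ct] := eqVneq ((crd [lie y, x])@_t) 0; first by rewrite scale0r.
by case: noT; exists t.
Qed.

End EnvelopingCenter.

(** * Current and loop algebras *)

Section LieMonoidAlgebras.
Context (K : fieldType) (l : lieAlgType K) (M : nmodType).
Context (I : choiceType) (e : I -> l) (eP : is_basis e).
Hypothesis l_centerless : forall x : l, (forall y, [lie y, x] = 0) -> x = 0.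
Hypothesis M_cancel : forall r : M, injective (fun s => s + r).
Context (h : nat -> M) (h_inj : injective h).

Lemma mcoeff_lmonom (x : l) (r s : M) : (x ⊗X^ r)@_s = x *+ (r == s).
Proof. exact: mcoeffU. Qed.

Let coordinates := cid (basis_coordinates eP).
Let crd : l -> {malg K[I]} := sval coordinates.

Let crd_linear : linear crd.
Proof. by case: (svalP coordinates). Qed.

Let crdK : cancel crd (lext e).
Proof. by case: (svalP coordinates). Qed.

Let crdb j : crd (e j) = 'z_j.
Proof. by case: (svalP coordinates). Qed.

HB.instance Definition _ := GRing.isLinear.Build K l {malg K[I]} _ crd crd_linear.

Let coord (ir : I * M) (w : lmonoid l M) : K^o := (crd w@_ir.2)@_ir.1.

Let coord_linear ir : linear (coord ir).
Proof.
move=> a u v; rewrite /coord mcoeffD.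
have -> : (a *: u)@_ir.2 = a *: u@_ir.2 by apply: lmscaleE.
by rewrite linearP /= mcoeffD mcoeffZ.
Qed.

HB.instance Definition _ ir :=
  GRing.isLinear.Build K (lmonoid l M) K^o _ (coord ir) (coord_linear ir).

Let coord_basis ir js : coord ir (e js.1 ⊗X^ js.2) = (js == ir)%:R.
Proof.
rewrite /coord mcoeff_lmonom -pair_eqE /=; case: eqP => _; rewrite ?andbT ?andbF.
  by rewrite crdb mcoeff_z.
by rewrite linear0 mcoeff0.
Qed.

Lemma lmonoid_basis : is_basis (fun ir : I * M => e ir.1 ⊗X^ ir.2).
Proof.
split=> [n j a j_inj sum0 k|].
  have := congr1 (coord (j k)) sum0; rewrite linear_sum linear0 /= (bigD1 k) //=.
  rewrite linearZ /= coord_basis eqxx big1 => [|i ik].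
    by rewrite addr0 => <-; rewrite /GRing.scale /= mulr1.
  by rewrite linearZ /= coord_basis (inj_eq j_inj) (negbTE ik) scaler0.
apply/seteqP; split=> // u _; elim/lmonoid_ind: u => [|x r u IH].
  by case: (linear_span_subspace (range (fun ir : I * M => e ir.1 ⊗X^ ir.2))).
apply: (subspaceD (linear_span_subspace _)) => //.
rewrite -[x]crdK lextE (big_morph (fun x => x ⊗X^ r) (lmonomD r) (lmonom0 _ r)).
apply: (subspace_sum (linear_span_subspace _)) => i _ _.
rewrite -scale_lmonom; apply: (subspaceZ (linear_span_subspace _)).
by move=> W [_]; apply; exists (i, r).
Qed.

(** As M is cancellative, the exponent r + s is reached from r only by adding s. *)
Lemma lie_lmonom_coef (x : l) (r s : M) (v : lmonoid l M) :
  [lie x ⊗X^ r, v]@_(r + s) = [lie x, v@_s].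
Proof.
elim/lmonoid_ind: v => [|y t v IH].
  by rewrite lie_x0 !mcoeff0 lie_x0.
rewrite lie_xD !mcoeffD IH lie_xD lie_lmonom !mcoeff_lmonom; congr (_ + _).
rewrite [r + t]addrC [r + s]addrC (inj_eq (@M_cancel r)).
by case: eqP; rewrite ?lie_x0.
Qed.

(** Some v_r, some [x, v_r] and some coordinate i of it are nonzero. Bracketing with x X^(h n) moves
    [x, v_r] to the exponent h n + r; these exponents are pairwise distinct, so some (i, h n + r)
    avoids F. *)
Lemma lmonoid_ad_infinite (F : {fset (I * M)}) (v : lmonoid l M) : v != 0 ->
  exists (y : lmonoid l M) (phi : {linear lmonoid l M -> K^o}),
    (forall ir, ir \in F -> phi (e ir.1 ⊗X^ ir.2) = 0) /\ phi [lie y, v] != 0.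
Proof.
move=> v0.
have [r vr] : exists r, v@_r != 0.
  apply: contrapT => noR; move/eqP: v0; apply; apply/malgP => r.
  by rewrite mcoeff0; apply: contrapT => vr; apply: noR; exists r; apply/eqP.
have [x xvr] : exists x, [lie x, v@_r] != 0.
  apply: contrapT => noX; move/eqP: vr; apply; apply: l_centerless => x.
  by apply: contrapT => xvr; apply: noX; exists x; apply/eqP.
have [i xi] : exists i, (crd [lie x, v@_r])@_i != 0.
  apply: contrapT => noI; move/eqP: xvr; apply; rewrite -[LHS]crdK.
  suff -> : crd [lie x, v@_r] = 0 by rewrite linear0.
  apply/malgP => i; rewrite mcoeff0; apply: contrapT => xi.
  by apply: noI; exists i; apply/eqP.
have [n nF] : exists n, (i, h n + r) \notin F.
  apply: contrapT => noN.
  (* Pigeonhole: one more pair than F has elements. *)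
  pose s := [seq (i, h n + r) | n <- iota 0 (size F).+1].
  have s_uniq : uniq s.
    by rewrite map_inj_uniq ?iota_uniq // => n n' [] /M_cancel/h_inj.
  have : (size s <= size F)%N.
    apply: uniq_leq_size s_uniq _ => _ /mapP[n _ ->].
    by apply: contraT => nF; case: noN; exists n.
  by rewrite size_map size_iota ltnn.
exists (x ⊗X^ (h n)), (coord (i, h n + r)); split=> [ir irF|].
  by rewrite /= coord_basis; case: eqP nF irF => // -> /negbTE ->.
by rewrite /= /coord /= lie_lmonom_coef.
Qed.

End LieMonoidAlgebras.

(** The center is an abelian ideal, hence solvable, hence zero. *)
Lemma semisimple_centerless (K : fieldType) (l : lieAlgType K) :
  lie_semisimple l -> forall x : l, (forall y, [lie y, x] = 0) -> x = 0.
Proof.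
move=> ss; pose C : set l := [set x | forall y, [lie y, x] = 0]%classic.
have C_sub : is_subspace C.
  split=> [y|a u v Cu Cv y]; first exact: lie_x0.
  by rewrite lie_linearr Cu Cv scaler0 addr0.
suff C0 : C = [set 0]%classic by move=> x Cx; have : C x by []; rewrite C0.
apply: ss; first by split=> // x u Cu y; rewrite Cu lie_x0.
exists 1%N => x /= /(_ [set 0]%classic); apply; split.
  by split=> // a u v /= -> ->; rewrite scaler0 addr0.
by move=> _ [u [v [Cu Cv ->]]] /=; apply: Cv.
Qed.

Lemma center_of_lmonoid (K : fieldType) (p : nat) (charK : p \in [pchar K])
    (l : lieAlgType K) (M : nmodType) (I : Type) (e : I -> l)
    (h : nat -> M) (pg : lmonoid l M -> lmonoid l M) :
    lie_semisimple l -> is_basis e ->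
    (forall r : M, injective (fun s => s + r)) -> injective h ->
    (forall x y, [lie pg x, y] = iter p (lie_bracket x) y) ->
  freely_generated (ring_center (A := envel (lmonoid l M)))
    (fun ir : I * M => let e_ir := e ir.1 ⊗X^ ir.2 in
       envel_in e_ir ^+ p - envel_in (pg e_ir)).
Proof.
move=> ss eP M_cancel h_inj pgP; have l_cl := semisimple_centerless ss.
(* [{classic I}] equips I with the classical choice structure required of the index type. *)
apply: (@envel_center_free K p charK (lmonoid l M) ({classic I} * M)%type
  (fun ir => e ir.1 ⊗X^ ir.2) (fun ir => pg (e ir.1 ⊗X^ ir.2))).
- exact: (@lmonoid_basis K l M {classic I} e eP).
- by move=> ir y; apply: pgP.
- exact: (@lmonoid_ad_infinite K l M {classic I} e eP l_cl M_cancel h h_inj).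
Qed.

Theorem proposition4p5 (K : closedFieldType) (p : nat)
    (charK : p \in [pchar K])
    (l : lieAlgType K) (pm : l -> l) (pmP : restricted_structure p pm)
    (ss : lie_semisimple l)
    (I : Type) (e : I -> l) (eP : is_basis e) :
  (forall pg : current l -> current l,
     restricted_structure p pg ->
     (forall (i : I) (r : nat), pg (e i ⊗X^ r) = pm (e i) ⊗X^ (r * p)%N) ->
     freely_generated (@ring_center (envel (current l)))
       (fun ir : I * nat => let e_ir := e ir.1 ⊗X^ ir.2 in
          envel_in e_ir ^+ p - envel_in (pg e_ir))) /\
  (forall pg : loop l -> loop l,
     restricted_structure p pg ->
     (forall (i : I) (r : int), pg (e i ⊗X^ r) = pm (e i) ⊗X^ (r * p%:Z)) ->
     freely_generated (@ring_center (envel (loop l)))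
       (fun ir : I * int => let e_ir := e ir.1 ⊗X^ ir.2 in
          envel_in e_ir ^+ p - envel_in (pg e_ir))).
Proof.
split=> pg [pg_ad _ _] _.
(* Both exponent monoids are cancellative, and [id], like [Posz] for the integers, supplies
   infinitely many exponents. *)
- by apply: (center_of_lmonoid charK ss eP (h := id)) => // r; apply: addIn.
- apply: (center_of_lmonoid charK ss eP (h := Posz)) => // [r|m n []] //.
  exact: addIr.
Qed.
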